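(* Fix testing parameters $\varepsilon,\alpha\in[0,1/2)$ and privacy parameter $\xi>0$. Let $\hat p$ and $q$ be known distributions over $[n]$, and let $p$ be an unknown distribution over $[n]$. Let $\eta:=d_{\rm TV}(q,\hat p)$. Then, if $\eta>\alpha$, any $\xi$-differentially private augmented testing algorithm with accuracy parameter $\alpha$, distance parameter $\varepsilon$ and error probability $\delta=0.2$, for testing identity of $p$ and $q$ with prediction $\hat p$, requires $s$ samples, where $$ s\ \ge\ \Omega\left(\min\left(\frac{1}{(\eta-\alpha)^2}+\frac{1}{\xi(\eta-\alpha)},\ \frac{\sqrt n}{\varepsilon^2}+\frac{n^{1/3}}{\varepsilon^{4/3}\xi^{2/3}}+\frac{\sqrt n}{\varepsilon\sqrt{\xi}}+\frac{1}{\varepsilon\xi}\right)\right). $$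
   Context: $[n]=\{1,\dots,n\}$. For distributions $p,q$ on $[n]$, $d_{\rm TV}(p,q)=\max_{S\subseteq[n]}|p(S)-q(S)|=\frac12\|p-q\|_1$. Differential privacy: for datasets $X,X'$, $\operatorname{Ham}(X,X')$ is the number of samples in which they differ. A randomized algorithm $\mathcal A$ is $\xi$-differentially private if for all $X,X'$ with $\operatorname{Ham}(X,X')=1$ and all sets $O$ of outputs, $\Pr[\mathcal A(X)\in O]\le e^{\xi}\Pr[\mathcal A(X')\in O]$. Augmented identity testing: let $q$ (reference) and $\hat p$ (prediction) be known distributions over $[n]$. A randomized algorithm $\mathcal A$ receiving $s$ i.i.d. samples from an unknown distribution $p$ over $[n]$ and returning a value in $\{\mathsf{accept},\mathsf{reject},\bot\}$ is an augmented testing algorithm for identity of $p$ and $q$ with prediction $\hat p$, distance parameter $\varepsilon$, accuracy parameter $\alpha$ and error probability $\delta$ if: (1) if $p=q$, $\mathcal A$ outputs $\mathsf{reject}$ with probability at most $\delta$; (2) if $d_{\rm TV}(p,q)>\varepsilon$, $\mathcal A$ outputs $\mathsf{accept}$ with probability at most $\delta$; (3) if $d_{\rm TV}(p,\hat p)\le\alpha$, $\mathcal A$ outputs $\bot$ with probability at most $\delta$.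
   Formalization: The bound is proved in the worst case: for all n≥2, ε, α, ξ and η in (α,1] some pair q, p̂ with d_TV(q,p̂)=η obeys it with a universal constant; for every pair it is false (q a point mass, p̂ moving mass η to another point). *)

(* Defs.v *)
From HB Require Import structures.
From mathcomp Require Import all_boot all_order all_algebra.
From mathcomp Require Import all_classical all_reals all_analysis.

Set Implicit Arguments.
Unset Strict Implicit.
Unset Printing Implicit Defensive.

Import Order.TTheory GRing.Theory Num.Theory.
Local Open Scope ring_scope.

(** Probability distributions on a finite type, given by their mass function. *)
Record fdist (R : realType) (T : finType) := FDist {
  pmf :> T -> R ;
  pmf_ge0 : forall x, 0 <= pmf x ;
  pmf_sum1 : \sum_(x : T) pmf x = 1 }.

Definition Prob (R : realType) (T : finType) (p : fdist R T) (S : {set T}) : R :=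
  \sum_(x in S) p x.

(** The base point [0] of the maximum is harmless: it is the value at [set0]. *)
Definition dTV (R : realType) (T : finType) (p q : fdist R T) : R :=
  \big[Num.max/0]_(S : {set T}) `|Prob p S - Prob q S|.

Lemma dTV_half_l1 (R : realType) (T : finType) (p q : fdist R T) :
  dTV p q = 2^-1 * \sum_(x : T) `|p x - q x|.
Proof.
pose d x := p x - q x.
have d0 : \sum_x d x = 0 by rewrite sumrB !pmf_sum1 subrr.
have PE (S : {set T}) : Prob p S - Prob q S = \sum_(x in S) d x.
  by rewrite /Prob sumrB.
have sumC (S : {set T}) (F : T -> R) :
    \sum_x F x = \sum_(x in S) F x + \sum_(x in ~: S) F x.
  rewrite (bigID (mem S)) /=; congr +%R.
  by apply: eq_bigl => x; rewrite finset.in_setC.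
have half (S : {set T}) : \sum_(x in S) d x = - \sum_(x in ~: S) d x.
  by apply/eqP; rewrite -subr_eq0 opprK -sumC d0.
have l1 (S : {set T}) := sumC S (fun x => `|d x|).
apply/eqP; rewrite eq_le; apply/andP; split.
  apply: (big_ind (fun y => y <= 2^-1 * \sum_x `|d x|)).
  - by rewrite mulr_ge0 ?invr_ge0 ?ler0n ?sumr_ge0.
  - by move=> x y hx hy; rewrite ge_max hx.
  move=> S _; rewrite PE ler_pdivlMl ?ltr0n// mulr_natl mulr2n (l1 S) lerD//.
    exact: ler_norm_sum.
  by rewrite half normrN; exact: ler_norm_sum.
pose S := [set x | 0 <= d x].
have -> : 2^-1 * \sum_x `|d x| = `|Prob p S - Prob q S|.
  have eS : \sum_(x in S) `|d x| = \sum_(x in S) d x.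
    by apply: eq_bigr => x; rewrite inE => /ger0_norm.
  have eC : \sum_(x in ~: S) `|d x| = \sum_(x in S) d x.
    rewrite half -sumrN; apply: eq_bigr => x.
    by rewrite !inE -ltNge => /ltr0_norm.
  rewrite PE (l1 S) eS eC -mulr2n -[X in _ * X]mulr_natl mulKf ?pnatr_eq0//.
  by rewrite ger0_norm// sumr_ge0// => x; rewrite inE.
exact: le_bigmax.
Qed.

Inductive verdict := Accept | Reject | Bot.

Definition verdict_code (v : verdict) : 'I_3 :=
  match v with
  | Accept => inord 0
  | Reject => inord 1
  | Bot => inord 2
  end.

Definition verdict_decode (i : 'I_3) : verdict :=
  match val i with
  | 0%N => Accept
  | 1%N => Reject
  | _ => Bot
  end.

Lemma verdict_codeK : cancel verdict_code verdict_decode.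
Proof. by case; rewrite /verdict_decode /= inordK. Qed.

HB.instance Definition _ := Finite.copy verdict (can_type verdict_codeK).

Definition dataset (n s : nat) := {ffun 'I_s -> 'I_n}.

Definition Ham (n s : nat) (X X' : dataset n s) : nat :=
  #|[set i | X i != X' i]|.

(** A randomized algorithm is a Markov kernel: each dataset is sent to the law
    of the verdict over the internal randomness. *)
Definition algorithm (R : realType) (n s : nat) := dataset n s -> fdist R verdict.

Definition dp (R : realType) (n s : nat) (xi : R) (A : algorithm R n s) : Prop :=
  forall X X' : dataset n s, Ham X X' = 1%N ->
  forall O : {set verdict}, Prob (A X) O <= expR xi * Prob (A X') O.

(** Probability of the verdict [v] over both the [s] i.i.d. samples from [p]
    and the internal randomness. *)
Definition verdict_prob (R : realType) (n s : nat) (A : algorithm R n s)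
    (p : fdist R 'I_n) (v : verdict) : R :=
  \sum_(X : dataset n s) (\prod_(i < s) p (X i)) * A X v.

Definition augmented_tester (R : realType) (n s : nat) (q phat : fdist R 'I_n)
    (eps alpha delta : R) (A : algorithm R n s) : Prop :=
  forall p : fdist R 'I_n,
  [/\ p = q -> verdict_prob A p Reject <= delta,
      eps < dTV p q -> verdict_prob A p Accept <= delta &
      dTV p phat <= alpha -> verdict_prob A p Bot <= delta].

Definition prediction_rate (R : realType) (gap xi : R) : R :=
  1 / gap ^+ 2 + 1 / (xi * gap).

(** At [eps = 0] every term is infinite, whereas division by zero in a
    field returns [0]; hence the extended real. *)
Definition identity_rate (R : realType) (n : nat) (eps xi : R) : \bar R :=
  if eps == 0 then +oo%E else
  (Num.sqrt n%:R / eps ^+ 2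
   + n%:R `^ (1 / 3) / (eps `^ (4 / 3) * xi `^ (2 / 3))
   + Num.sqrt n%:R / (eps * Num.sqrt xi)
   + 1 / (eps * xi))%:E.

(* Main.v *)
Require Import Defs.
From mathcomp Require Import all_boot all_order all_algebra.
From mathcomp Require Import all_classical all_reals all_analysis.
From mathcomp Require Import perm ring lra.

Set Implicit Arguments.
Unset Strict Implicit.
Unset Printing Implicit Defensive.

Import Order.TTheory GRing.Theory Num.Theory.
Local Open Scope ring_scope.

(** Under [q] the verdict is [Reject] with probability at most [1/5], so one
    of [Bot] and [Accept] has probability at least [2/5]; it is compared with
    a witness under which that verdict has probability at most [1/5].

    If it is [Bot], the witness lies on the segment from [q] to [phat], at
    distance [alpha] from [phat] and [eta - alpha] from [q]; the
    chi-squared divergence of the [s]-fold products gives the [1/gap^2] term,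
    and changing the samples one at a time, at a cost of [xi] each by
    privacy, gives the [1/(xi gap)] term.

    If it is [Accept], [q] is uniform on pairs of points and the witness is
    the uniform mixture over sign vectors [z] of the distributions [p_z] that
    shift a fraction [z_k gam] of the mass within the [k]-th pair.  Ingster's
    chi-squared computation gives [sqrt n / eps^2].  For the private terms,
    the samples are again replaced one at a time, from [q] to [p_z]: in the
    [i]-th step, swapping the two points of the pair of the [i]-th sample and
    flipping the sign [z_k] of that pair turn the increment into a second
    difference, at most [xi] times the total variation between the other
    samples under [p_z] and under [p_z] with [z_k] flipped.  Bounding the
    latter by [s gam / m] or by [sqrt (s gam^2 / m)], for [m] pairs, gives the
    two intermediate terms of the rate.

    The pair ([q], [phat]) is ours to choose: when the gap is at least [1/16]
    it is supported on two points, where the trivial bounds [1] and [1/xi]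
    already match the rate, and when [n < 4] a two-point [q] is also used for
    [Accept], all terms of the identity rate being dominated by its first and
    last one.  *)

(** * Expectations under product weights and chi-squared bounds *)

(** The weights may vary with the sample and may be signed, so that the expression is multilinear in
    them and also covers differences of laws. *)
Definition pexpect (R : realType) (T : finType) (s : nat) (w : 'I_s -> T -> R)
    (f : {ffun 'I_s -> T} -> R) : R :=
  \sum_(X : {ffun 'I_s -> T}) (\prod_i w i (X i)) * f X.

Definition is_pmf (R : realType) (T : finType) (w : T -> R) : Prop :=
  (forall x, 0 <= w x) /\ \sum_x w x = 1.

Lemma sum_prod_ffun (R : realType) (T : finType) (s : nat) (w : 'I_s -> T -> R) :
  \sum_(X : {ffun 'I_s -> T}) \prod_i w i (X i) = \prod_i \sum_x w i x.
Proof. by rewrite bigA_distr_bigA. Qed.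

Lemma sum_prod_pmf (R : realType) (T : finType) (s : nat) (w : 'I_s -> T -> R) :
  (forall i, is_pmf (w i)) ->
  \sum_(X : {ffun 'I_s -> T}) \prod_i w i (X i) = 1.
Proof. by move=> hw; rewrite sum_prod_ffun big1// => i _; case: (hw i). Qed.

(** The variance of [h] under the weights [w] is nonnegative. *)
Lemma sqr_wmean_le (R : realType) (I : finType) (w h : I -> R) :
  (forall i, 0 <= w i) -> \sum_i w i = 1 ->
  (\sum_i w i * h i) ^+ 2 <= \sum_i w i * h i ^+ 2.
Proof.
move=> w0 w1; set a := \sum_i w i * h i.
have : 0 <= \sum_i w i * (h i - a) ^+ 2.
  by apply: sumr_ge0 => i _; rewrite mulr_ge0// sqr_ge0.
have var b : \sum_i w i * (h i - b) ^+ 2 =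
    \sum_i w i * h i ^+ 2 - 2 * b * (\sum_i w i * h i) + b ^+ 2 * \sum_i w i.
  rewrite !big_distrr/= -sumrN -!big_split/=.
  by apply: eq_bigr => i _; ring.
by rewrite var w1 -/a => h0; nra.
Qed.

(** Ingster's method: the gap is the mean of [(L - 1) * f] under [Q], with [L] the likelihood ratio
    of the mixture, so its square is at most the variance of [L]. Expanding [L ^+ 2] over two
    indices leaves products over the samples, whose means factorise. *)
Lemma pexpect_mixture_chi2 (R : realType) (T Z : finType) (s : nat)
    (Q : 'I_s -> T -> R) (mu : Z -> R) (u : Z -> 'I_s -> T -> R)
    (f : {ffun 'I_s -> T} -> R) :
  (forall i, is_pmf (Q i)) -> \sum_z mu z = 1 ->
  (forall z i, \sum_x Q i x * u z i x = 0) -> (forall X, `|f X| <= 1) ->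
  (\sum_z mu z * pexpect (fun i x => Q i x * (1 + u z i x)) f
     - pexpect Q f) ^+ 2
  <= \sum_z \sum_z' mu z * mu z' *
       \prod_i (1 + \sum_x Q i x * (u z i x * u z' i x)) - 1.
Proof.
move=> hQ mu1 u0 f1.
pose W (X : {ffun 'I_s -> T}) := \prod_i Q i (X i).
pose Lz z (X : {ffun 'I_s -> T}) := \prod_i (1 + u z i (X i)).
pose L X := \sum_z mu z * Lz z X.
have W0 X : 0 <= W X by apply: prodr_ge0 => i _; case: (hQ i) => ->.
have W1 : \sum_X W X = 1 by exact: sum_prod_pmf.
have -> : \sum_z mu z * pexpect (fun i x => Q i x * (1 + u z i x)) f
     - pexpect Q f = \sum_X W X * ((L X - 1) * f X).
  rewrite /pexpect.
  under eq_bigr do rewrite big_distrr/=.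
  rewrite exchange_big/= -sumrB; apply: eq_bigr => X _.
  rewrite -/(W X) /L !(mulrBl, mulrBr) mul1r; congr (_ - _).
  rewrite mulrA big_distrr/= big_distrl/=; apply: eq_bigr => z _.
  by rewrite big_split/= -/(W X) -/(Lz z X); ring.
apply: le_trans (sqr_wmean_le _ W0 W1) _.
have WL : \sum_X W X * L X = 1.
  under eq_bigr do rewrite /L big_distrr/=.
  rewrite exchange_big/= -mu1; apply: eq_bigr => z _.
  under eq_bigr do rewrite mulrCA -big_split/=.
  rewrite -big_distrr/= (sum_prod_ffun (fun i x => Q i x * (1 + u z i x))).
  rewrite big1 ?mulr1// => i _.
  under eq_bigr do rewrite mulrDr mulr1.
  by rewrite big_split/= u0 addr0; case: (hQ i).
have WLL : \sum_X W X * L X ^+ 2 = \sum_z \sum_z' mu z * mu z' *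
       \prod_i (1 + \sum_x Q i x * (u z i x * u z' i x)).
  transitivity (\sum_(X : {ffun 'I_s -> T}) \sum_z \sum_z' mu z * mu z' *
     \prod_i (Q i (X i) * ((1 + u z i (X i)) * (1 + u z' i (X i))))).
    apply: eq_bigr => X _; rewrite expr2 /L big_distrl/= big_distrr/=.
    apply: eq_bigr => z _; rewrite big_distrr big_distrr/=.
    by apply: eq_bigr => z' _; rewrite !big_split/= -/(W X) -/(Lz z X) -/(Lz z' X); ring.
  rewrite exchange_big/=; apply: eq_bigr => z _.
  rewrite exchange_big/=; apply: eq_bigr => z' _.
  rewrite -big_distrr/=; congr (_ * _).
  rewrite (sum_prod_ffun (fun i x => Q i x * ((1 + u z i x) * (1 + u z' i x)))).
  apply: eq_bigr => i _.
  transitivity (\sum_x (Q i x + Q i x * u z i x + Q i x * u z' i x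
      + Q i x * (u z i x * u z' i x))).
    by apply: eq_bigr => x _; ring.
  by rewrite !big_split/= !u0 !addr0; case: (hQ i) => _ ->.
rewrite -WLL.
apply: (@le_trans _ _ (\sum_X W X * (L X - 1) ^+ 2)).
  apply: ler_sum => X _; apply: ler_wpM2l => //.
  rewrite exprMn ler_piMr ?sqr_ge0//.
  by rewrite -real_normK ?num_real// expr_le1.
rewrite (_ : \sum_X W X * (L X - 1) ^+ 2 =
  \sum_X W X * L X ^+ 2 - 2 * (\sum_X W X * L X) + \sum_X W X).
  by rewrite WL W1; lra.
by rewrite big_distrr/= -sumrN -!big_split/=; apply: eq_bigr => X _; ring.
Qed.

(** With [y = s * x], the power is at most [expR y <= 1 / (1 - y)]; hence
    [expR y - 1 <= y * expR y], and [expR y <= 2] for [y <= 1 / 2]. *)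
Lemma pow_1Dx_sub1_le (R : realType) (x : R) (s : nat) :
  0 <= x -> s%:R * x <= 1 / 2 -> (1 + x) ^+ s - 1 <= 2 * (s%:R * x).
Proof.
move=> x0 sx; set y := s%:R * x in sx *.
have y0 : 0 <= y by rewrite mulr_ge0.
have h1 : (1 + x) ^+ s <= expR y.
  by rewrite /y expRM_natl lerXn2r// ?nnegrE ?addr_ge0 ?expR_ge0 ?expR_ge1Dx.
have h2 : expR y * (1 - y) <= 1.
  have := expR_ge1Dx (- y); rewrite expRN => h.
  apply: (@le_trans _ _ (expR y * (expR y)^-1)).
    by rewrite ler_wpM2l ?expR_ge0.
  by rewrite mulfV// gt_eqF// expR_gt0.
have := expR_ge0 y; nra.
Qed.

Lemma norm_pexpect_le (R : realType) (T : finType) (s : nat)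
    (w : 'I_s -> T -> R) (f : {ffun 'I_s -> T} -> R) :
  (forall i, is_pmf (w i)) -> (forall X, `|f X| <= 1) ->
  `|pexpect w f| <= 1.
Proof.
move=> hw f1; apply: le_trans (ler_norm_sum _ _ _) _.
rewrite -[leRHS](sum_prod_pmf hw); apply: ler_sum => X _.
have w0 : 0 <= \prod_i w i (X i) by apply: prodr_ge0 => i _; case: (hw i) => ->.
by rewrite normrM (ger0_norm w0) ler_piMr.
Qed.

(** When [s * chi] exceeds [1/2] the bound is trivial. *)
Lemma pexpect_chi2 (R : realType) (T : finType) (s : nat)
    (Q u : 'I_s -> T -> R) (chi : R) (f : {ffun 'I_s -> T} -> R) :
  (forall i, is_pmf (Q i)) -> (forall i x, 0 <= 1 + u i x) ->
  (forall i, \sum_x Q i x * u i x = 0) ->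
  (forall i, \sum_x Q i x * u i x ^+ 2 <= chi) ->
  0 <= chi -> (forall X, `|f X| <= 1) ->
  (pexpect (fun i x => Q i x * (1 + u i x)) f - pexpect Q f) ^+ 2
  <= 8 * (s%:R * chi).
Proof.
move=> hQ u1 u0 uc c0 f1.
have y0 : 0 <= s%:R * chi by rewrite mulr_ge0.
have [sc|sc] := lerP (s%:R * chi) (1 / 2).
  have := @pexpect_mixture_chi2 R T unit s Q (fun=> 1) (fun=> u) f hQ.
  rewrite !big_const !card_unit /= !addr0 !mul1r => /(_ erefl (fun=> u0) f1) h.
  apply: le_trans h _.
  have : \prod_i (1 + \sum_x Q i x * (u i x * u i x)) <= (1 + chi) ^+ s.
    rewrite -[s in X in _ <= X]card_ord -prodr_const; apply: ler_prod => i _.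
    rewrite lerD2l; apply/andP; split; last exact: uc.
    rewrite addr_ge0// sumr_ge0// => x _.
    by rewrite mulr_ge0 -?expr2 ?sqr_ge0//; case: (hQ i).
  by have := pow_1Dx_sub1_le c0 sc; lra.
have hP i : is_pmf (fun x => Q i x * (1 + u i x)).
  split=> [x|]; first by rewrite mulr_ge0//; case: (hQ i).
  under eq_bigr do rewrite mulrDr mulr1.
  by rewrite big_split/= u0 addr0; case: (hQ i).
have := norm_pexpect_le hP f1; have := norm_pexpect_le hQ f1.
rewrite !ler_norml => /andP[a1 a2] /andP[b1 b2].
nra.
Qed.

(** * Bounded differences and replacement of the samples one at a time *)

(** The additive form in which privacy is used, with the privacy parameter as [K]; other values of
    [K] express mere boundedness of [f]. *)
Definition bounded_diff (R : realType) (T : finType) (s : nat) (K : R)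
    (f : {ffun 'I_s -> T} -> R) : Prop :=
  forall (i : 'I_s) (X X' : {ffun 'I_s -> T}),
  (forall j, j != i -> X j = X' j) -> `|f X - f X'| <= K.

Definition map_at (T : finType) (s : nat) (i : 'I_s) (tau : T -> T)
    (X : {ffun 'I_s -> T}) : {ffun 'I_s -> T} :=
  [ffun j => if j == i then tau (X j) else X j].

Lemma map_atK (T : finType) (s : nat) (i : 'I_s) (tau : T -> T) :
  involutive tau -> involutive (map_at i tau).
Proof.
by move=> tauK X; apply/ffunP => j; rewrite !ffunE; case: eqP => // _; rewrite tauK.
Qed.

Lemma map_at_eq (T : finType) (s : nat) (i : 'I_s) (tau : T -> T) X :
  map_at i tau X i = tau (X i).
Proof. by rewrite ffunE eqxx. Qed.

Lemma map_at_neq (T : finType) (s : nat) (i j : 'I_s) (tau : T -> T) X :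
  j != i -> map_at i tau X j = X j.
Proof. by rewrite ffunE => /negbTE ->. Qed.

Definition replace (A : Type) (s : nat) (w : 'I_s -> A) (i : 'I_s) (a : A)
    (j : 'I_s) : A := if j == i then a else w j.

Lemma prod_replace (R : realType) (T : finType) (s : nat) (w : 'I_s -> T -> R)
    (i : 'I_s) (g : T -> R) (X : {ffun 'I_s -> T}) :
  \prod_j replace w i g j (X j) = g (X i) * \prod_(j | j != i) w j (X j).
Proof.
rewrite (bigD1 i)//= {1}/replace eqxx; congr (_ * _).
by apply: eq_bigr => j /negbTE ji; rewrite /replace ji.
Qed.

Lemma eq_pexpect (R : realType) (T : finType) (s : nat) (w w' : 'I_s -> T -> R)
    (f : {ffun 'I_s -> T} -> R) :
  (forall i, w i =1 w' i) -> pexpect w f = pexpect w' f.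
Proof.
move=> ww'; apply: eq_bigr => X _; congr (_ * _).
by apply: eq_bigr => i _; rewrite ww'.
Qed.

Lemma pexpect_replaceB (R : realType) (T : finType) (s : nat)
    (w : 'I_s -> T -> R) (i : 'I_s) (a b : T -> R) (f : {ffun 'I_s -> T} -> R) :
  pexpect (replace w i a) f - pexpect (replace w i b) f =
  pexpect (replace w i (fun x => a x - b x)) f.
Proof.
rewrite /pexpect -sumrB; apply: eq_bigr => X _.
by rewrite !prod_replace; ring.
Qed.

Definition point_mass (R : realType) (T : finType) (x y : T) : R := (y == x)%:R.

Lemma point_mass_pmf (R : realType) (T : finType) (x : T) : is_pmf (@point_mass R T x).
Proof.
split=> [y|]; first exact: ler0n.
rewrite (bigD1 x)//= /point_mass eqxx big1 ?addr0// => y /negbTE ->//.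
Qed.

Lemma replace_pmf (R : realType) (T : finType) (s : nat) (w : 'I_s -> T -> R)
    (i : 'I_s) (a : T -> R) :
  (forall j, is_pmf (w j)) -> is_pmf a -> forall j, is_pmf (replace w i a j).
Proof. by move=> hw ha j; rewrite /replace; case: eqP. Qed.

Lemma pexpect_replace_point (R : realType) (T : finType) (s : nat)
    (w : 'I_s -> T -> R) (i : 'I_s) (d : T -> R) (f : {ffun 'I_s -> T} -> R) :
  pexpect (replace w i d) f = \sum_x d x * pexpect (replace w i (point_mass R x)) f.
Proof.
rewrite /pexpect; under [RHS]eq_bigr do rewrite big_distrr/=.
rewrite exchange_big/=; apply: eq_bigr => X _.
rewrite prod_replace; under [RHS]eq_bigr do rewrite prod_replace.
rewrite (bigD1 (X i))//= [X in _ = _ + X]big1 => [|x /negbTE xX].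
  by rewrite addr0 /point_mass eqxx mul1r mulrA.
by rewrite /point_mass eq_sym xX !(mul0r, mulr0).
Qed.

(** The factor [d] has zero mean, so only the oscillation of the conditional
    expectations of [f] given the [i]-th sample matters; swapping two values
    of that sample changes [f] by at most [K]. *)
Lemma pexpect_replace_le (R : realType) (T : finType) (s : nat) (K : R)
    (w : 'I_s -> T -> R) (i : 'I_s) (d : T -> R) (f : {ffun 'I_s -> T} -> R) :
  (forall j, is_pmf (w j)) -> \sum_x d x = 0 -> bounded_diff K f ->
  `|pexpect (replace w i d) f| <= K * \sum_x `|d x|.
Proof.
move=> hw d0 fK; rewrite pexpect_replace_point.
pose G x := pexpect (replace w i (point_mass R x)) f.
have GK x x' : `|G x - G x'| <= K.
  have -> : G x' = \sum_(X : {ffun 'I_s -> T})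
      (\prod_j replace w i (point_mass R x) j (X j)) * f (map_at i (tperm x x') X).
    rewrite /G /pexpect (reindex_inj (can_inj (map_atK i (tpermK x x'))))/=.
    apply: eq_bigr => X _; rewrite !prod_replace map_at_eq; congr (_ * _ * _).
      by rewrite /point_mass -{2}(tpermL x x') (inj_eq perm_inj).
    by apply: eq_bigr => j ji; rewrite map_at_neq.
  rewrite /G /pexpect -sumrB -[K]mul1r.
  rewrite -[X in _ <= X * K](sum_prod_pmf (replace_pmf i hw (point_mass_pmf R x))).
  rewrite big_distrl/=.
  apply: le_trans (ler_norm_sum _ _ _) _; apply: ler_sum => X _.
  rewrite -mulrBr normrM ger0_norm; last first.
    by apply: prodr_ge0 => j _; case: (replace_pmf i hw (point_mass_pmf R x) j).
  apply: ler_wpM2l; last by apply: (fK i) => j ji; rewrite map_at_neq.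
  by apply: prodr_ge0 => j _; case: (replace_pmf i hw (point_mass_pmf R x) j).
rewrite -/(G _).
have [x0 _|T0] := pickP (fun _ : T => true); last first.
  by rewrite !big_pred0 ?normr0 ?mulr0// => x; have := T0 x.
have -> : \sum_x d x * G x = \sum_x d x * (G x - G x0).
  under [RHS]eq_bigr do rewrite mulrBr.
  by rewrite sumrB -big_distrl/= d0 mul0r subr0.
apply: le_trans (ler_norm_sum _ _ _) _; rewrite big_distrr/=.
by apply: ler_sum => x _; rewrite normrM mulrC ler_wpM2r.
Qed.

Definition hybrid (A : Type) (s : nat) (w w' : 'I_s -> A) (k : nat)
    (j : 'I_s) : A := if (j < k)%N then w j else w' j.

Lemma hybridS (A : Type) (s : nat) (w w' : 'I_s -> A) (i j : 'I_s) :
  hybrid w w' i.+1 j = replace (hybrid w w' i) i (w i) j.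
Proof.
rewrite /hybrid /replace ltnS; case: eqP => [->|/eqP ji]; first by rewrite leqnn.
by rewrite leq_eqVlt (inj_eq val_inj) (negbTE ji).
Qed.

Lemma hybridE (A : Type) (s : nat) (w w' : 'I_s -> A) (i j : 'I_s) :
  hybrid w w' i j = replace (hybrid w w' i) i (w' i) j.
Proof.
by rewrite /replace; case: eqP => [->|//]; rewrite /hybrid ltnn.
Qed.

Lemma hybrid_pmf (R : realType) (T : finType) (s : nat)
    (w w' : 'I_s -> T -> R) (k : nat) :
  (forall i, is_pmf (w i)) -> (forall i, is_pmf (w' i)) ->
  forall i, is_pmf (hybrid w w' k i).
Proof. by move=> hw hw' i; rewrite /hybrid; case: ifP. Qed.

Lemma pexpect_hybrid_step (R : realType) (T : finType) (s : nat)
    (w w' : 'I_s -> T -> R) (f : {ffun 'I_s -> T} -> R) (i : 'I_s) :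
  pexpect (hybrid w w' i.+1) f - pexpect (hybrid w w' i) f =
  pexpect (replace (hybrid w w' i) i (fun x => w i x - w' i x)) f.
Proof.
rewrite -pexpect_replaceB; congr (_ - _); apply: eq_pexpect => j x.
  by rewrite hybridS.
by rewrite [in LHS]hybridE.
Qed.

Lemma pexpect_telescope (R : realType) (T : finType) (s : nat)
    (w w' : 'I_s -> T -> R) (f : {ffun 'I_s -> T} -> R) :
  pexpect w f - pexpect w' f =
  \sum_(i < s) pexpect (replace (hybrid w w' i) i (fun x => w i x - w' i x)) f.
Proof.
under eq_bigr do rewrite -pexpect_hybrid_step.
rewrite -(big_mkord predT (fun k => pexpect (hybrid w w' k.+1) f -
  pexpect (hybrid w w' k) f)) telescope_sumr//.
by congr (_ - _); apply: eq_pexpect => j x; rewrite /hybrid ?ltn_ord.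
Qed.

Lemma pexpect_bounded_diff (R : realType) (T : finType) (s : nat) (K : R)
    (w w' : 'I_s -> T -> R) (f : {ffun 'I_s -> T} -> R) :
  (forall i, is_pmf (w i)) -> (forall i, is_pmf (w' i)) -> bounded_diff K f ->
  `|pexpect w f - pexpect w' f| <= K * \sum_i \sum_x `|w i x - w' i x|.
Proof.
move=> hw hw' fK; rewrite pexpect_telescope.
apply: le_trans (ler_norm_sum _ _ _) _; rewrite big_distrr/=.
apply: ler_sum => i _; apply: pexpect_replace_le => //.
  exact: hybrid_pmf.
by rewrite sumrB; case: (hw i) => _ ->; case: (hw' i) => _ ->; rewrite subrr.
Qed.

(** The sign of the difference of the masses is the optimal test; bounds on bounded tests thus
    become bounds on the l1 distance. *)
Lemma pexpect_l1 (R : realType) (T : finType) (s : nat) (w w' : 'I_s -> T -> R) :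
  exists2 f : {ffun 'I_s -> T} -> R, (forall X, `|f X| <= 1) &
  \sum_(X : {ffun 'I_s -> T}) `|\prod_i w i (X i) - \prod_i w' i (X i)| =
  pexpect w f - pexpect w' f.
Proof.
exists (fun X => Num.sg (\prod_i w i (X i) - \prod_i w' i (X i))).
  by move=> X; rewrite normr_sg; case: eqP.
rewrite /pexpect -sumrB; apply: eq_bigr => X _.
by rewrite normrEsg -mulrBl mulrC.
Qed.

(** * The uniform law on pairs and its random perturbations *)

(** [I * bool] is a set of #|I| pairs of points; [zeta k] is the signed relative
    shift of mass within the pair [k]. *)
Definition pert (R : realType) (I : finType) (zeta : I -> R) (x : I * bool) : R :=
  (1 + (-1) ^+ x.2 * zeta x.1) / (2 * #|I|%:R).

Lemma sum_pairs (R : realType) (I : finType) (F : I * bool -> R) :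
  \sum_x F x = \sum_k (F (k, true) + F (k, false)).
Proof.
transitivity (\sum_k \sum_b F (k, b)).
  by rewrite pair_bigA; apply: eq_bigr => -[].
by apply: eq_bigr => k _; rewrite big_bool.
Qed.

Lemma pert_pmf (R : realType) (I : finType) (zeta : I -> R) :
  (0 < #|I|)%N -> (forall k, `|zeta k| <= 1) -> is_pmf (pert zeta).
Proof.
move=> I0 z1; have m0 : (0 : R) < #|I|%:R by rewrite ltr0n.
split=> [x|].
  rewrite /pert divr_ge0 ?mulr_ge0//.
  have := z1 x.1; rewrite ler_norml => /andP[h1 h2].
  by case: x.2; rewrite ?expr0 ?expr1; lra.
rewrite sum_pairs /pert/=.
under eq_bigr => k _ do rewrite expr0 expr1 -mulrDl mul1r mulN1r addrACA addNr addr0.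
rewrite -mulr_suml sumr_const -[(1 + 1) *+ _]mulr_natr.
by rewrite -[1 + 1]/(2%:R) divff// mulf_neq0// ?pnatr_eq0// gt_eqF.
Qed.

Section Paninski.
Variables (R : realType) (I : finType) (gam : R).
Hypotheses (I_gt0 : (0 < #|I|)%N) (gam01 : 0 < gam <= 1).
Let m : R := #|I|%:R.
Let T := (I * bool)%type.
Let Z := {ffun I -> bool}.
Let q : T -> R := pert (fun=> 0).
Let P (z : Z) : T -> R := pert (fun k => gam * (-1) ^+ z k).

Let m_gt0 : 0 < m. Proof. by rewrite ltr0n. Qed.
Let m_neq0 : m != 0. Proof. by rewrite gt_eqF. Qed.

Lemma paninski_pmf z : is_pmf (P z).
Proof.
apply: pert_pmf => // k; rewrite normrM normr_sign mulr1.
by case/andP: gam01 => g0 g1; rewrite ger0_norm// ltW.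
Qed.

Lemma unif_pmf : is_pmf q.
Proof. by apply: pert_pmf => // k; rewrite normr0. Qed.

Let qE x : q x = (2 * m)^-1.
Proof. by rewrite /q /pert mulr0 addr0 mul1r. Qed.

Lemma paninskiB z x : P z x - q x = gam * (-1) ^+ x.2 * (-1) ^+ z x.1 / (2 * m).
Proof. by rewrite qE /P /pert -/m; field. Qed.

(** Add [expR a <= 1 / (1 - a)] and [expR (- a) <= 1 / (1 + a)]. Bernoulli's inequality then
    controls powers of the rational bound. *)
Lemma cosh_le (a : R) : 0 <= a -> a < 1 -> expR a + expR (- a) <= 2 / (1 - a ^+ 2).
Proof.
move=> a0 a1; have h1 : expR a <= (1 - a)^-1.
  rewrite -[a in leLHS]opprK expRN lef_pV2 ?posrE ?expR_gt0 ?subr_gt0//.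
  by have := expR_ge1Dx (- a).
have h2 : expR (- a) <= (1 + a)^-1.
  rewrite expRN lef_pV2 ?posrE ?expR_gt0//; last lra.
  exact: expR_ge1Dx.
apply: le_trans (lerD h1 h2) _; rewrite le_eqVlt; apply/orP; left; apply/eqP.
by field; apply/and3P; split; rewrite gt_eqF//; nra.
Qed.

(** The sum over sign vectors factorises over the pairs, and the sign of [z k] only exchanges the
    two terms of a factor. *)
Lemma sum_expR_sign (a : R) (z : Z) :
  \sum_(z' : Z) \prod_k expR (a * ((-1) ^+ z k * (-1) ^+ z' k)) =
  (expR a + expR (- a)) ^+ #|I|.
Proof.
rewrite -(bigA_distr_bigA (fun k (b : bool) => expR (a * ((-1) ^+ z k * (-1) ^+ b)))).
rewrite -prodr_const; apply: eq_bigr => k _; rewrite big_bool/=.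
by case: (z k); rewrite ?expr0 ?expr1 !(mulN1r, mulrN, mul1r, opprK, mulr1)// addrC.
Qed.

Lemma bernoulli_le (x : R) (n : nat) : 0 <= x <= 1 -> 1 - n%:R * x <= (1 - x) ^+ n.
Proof.
case/andP => x0 x1; elim: n => [|n IH]; first by rewrite mul0r subr0 expr0.
rewrite exprS; apply: (@le_trans _ _ ((1 - x) * (1 - n%:R * x))).
  by rewrite -natr1; have := ler0n R n; nra.
by rewrite ler_wpM2l// subr_ge0.
Qed.

Lemma paninski_chi2 (s : nat) (f : {ffun 'I_s -> T} -> R) :
  (forall X, `|f X| <= 1) -> 30 * (s%:R ^+ 2 * gam ^+ 4) <= m ->
  (\sum_z #|Z|%:R^-1 * pexpect (fun=> P z) f - pexpect (fun=> q) f) ^+ 2 <= 1 / 29.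
Proof.
move=> f1 small; have /andP[g0 g1] := gam01.
have N0 : (0 : R) < #|Z|%:R.
  by rewrite ltr0n; apply/card_gt0P; exists [ffun=> true].
pose u (z : Z) (_ : 'I_s) (x : T) := gam * (-1) ^+ x.2 * (-1) ^+ z x.1.
have hu z : pexpect (fun=> P z) f = pexpect (fun i x => q x * (1 + u z i x)) f.
  by apply: eq_pexpect => i x; rewrite qE /P /pert -/m /u; ring.
under eq_bigr do rewrite hu.
have hmu : \sum_(z : Z) (#|Z|%:R^-1 : R) = 1.
  by rewrite sumr_const -[LHS]mulr_natr mulVf// gt_eqF.
have hu0 z i : \sum_x q x * u z i x = 0.
  rewrite sum_pairs big1// => k _; rewrite !qE /u/=; ring.
apply: le_trans (pexpect_mixture_chi2 (fun=> unif_pmf) hmu hu0 f1) _.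
(* The product over the samples is at most the exponential of [a] times the inner product of the two
   sign vectors. The hypothesis says that [m * a ^+ 2 <= 1 / 30], whence the [29 / 30] from
   Bernoulli's inequality. *)
pose a := s%:R * gam ^+ 2 / m.
have a0 : 0 <= a by rewrite !mulr_ge0 ?invr_ge0 ?sqr_ge0// ltW.
have ma2 : 30 * (m * a ^+ 2) <= 1.
  have -> : m * a ^+ 2 = (s%:R ^+ 2 * gam ^+ 4) / m by rewrite /a; field.
  by rewrite mulrA ler_pdivrMr// mul1r.
have m1 : 1 <= m by rewrite ler1n.
have a1 : a ^+ 2 <= 1 / 30 by have := sqr_ge0 a; nra.
have a2 : a < 1 by nra.
have inner z z' : \prod_(i < s) (1 + \sum_x q x * (u z i x * u z' i x)) <=
    \prod_k expR (a * ((-1) ^+ z k * (-1) ^+ z' k)).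
  pose S := \sum_k ((-1) ^+ z k * (-1) ^+ z' k : R).
  have -> : \prod_(i < s) (1 + \sum_x q x * (u z i x * u z' i x)) =
      (1 + gam ^+ 2 / m * S) ^+ s.
    rewrite -[s in RHS]card_ord -prodr_const; apply: eq_bigr => i _; congr (_ + _).
    rewrite sum_pairs /S big_distrr/=; apply: eq_bigr => k _.
    by rewrite !qE /u/= expr0 expr1; field.
  have SM : `|S| <= m.
    apply: le_trans (ler_norm_sum _ _ _) _.
    under eq_bigr do rewrite normrM !normr_sign mulr1.
    by rewrite sumr_const.
  have -> : \prod_k expR (a * ((-1) ^+ z k * (-1) ^+ z' k)) =
      expR (gam ^+ 2 / m * S) ^+ s.
    rewrite -expRM_natl -expR_sum; congr expR.
    by rewrite -big_distrr/= -/S /a; ring.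
  apply: lerXn2r; rewrite ?nnegrE ?expR_ge0 ?expR_ge1Dx//.
  (* This makes the base nonnegative, as raising an inequality to the power [s] requires. *)
  have : `|gam ^+ 2 / m * S| <= 1.
    rewrite normrM ger0_norm ?divr_ge0 ?sqr_ge0 ?(ltW m_gt0)//.
    rewrite mulrAC ler_pdivrMr// mul1r (le_trans _ SM)// ler_piMl//.
    by rewrite exprn_ile1// ltW.
  by rewrite ler_norml; lra.
have mean z : \sum_z' \prod_(i < s) (1 + \sum_x q x * (u z i x * u z' i x)) <=
    #|Z|%:R * (30 / 29).
  apply: le_trans (ler_sum _ (fun z' _ => inner z z')) _.
  rewrite sum_expR_sign; apply: (@le_trans _ _ ((2 / (1 - a ^+ 2)) ^+ #|I|)).
    by rewrite lerXn2r ?nnegrE ?addr_ge0 ?expR_ge0 ?divr_ge0 ?cosh_le//; lra.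
  rewrite expr_div_n card_ffun card_bool natrX ler_wpM2l ?exprn_ge0//.
  have -> : (30 / 29 : R) = (29 / 30)^-1 by field.
  have b0 : 29 / 30 <= (1 - a ^+ 2) ^+ #|I|.
    apply: le_trans (@bernoulli_le (a ^+ 2) #|I| _).
      by rewrite -/m; lra.
    by rewrite sqr_ge0/=; lra.
  by rewrite lef_pV2 ?posrE//; lra.
have : \sum_z \sum_z' #|Z|%:R^-1 * #|Z|%:R^-1 *
       \prod_(i < s) (1 + \sum_x q x * (u z i x * u z' i x)) <= 30 / 29.
  apply: (@le_trans _ _ (\sum_(z : Z) #|Z|%:R^-1 * (30 / 29))).
    apply: ler_sum => z _; rewrite -big_distrr/= -mulrA ler_wpM2l ?invr_ge0 ?(ltW N0)//.
    by rewrite ler_pdivrMl.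
  by rewrite -big_distrl/= hmu mul1r.
lra.
Qed.

(** * The hybrid argument with sign flips *)

Definition flip_at (k : I) (z : Z) : Z := [ffun l => if l == k then ~~ z l else z l].

Lemma flip_atK k : involutive (flip_at k).
Proof.
by move=> z; apply/ffunP => l; rewrite !ffunE; case: eqP => // _; rewrite negbK.
Qed.

Definition neg_pair (x : T) : T := (x.1, ~~ x.2).

Lemma neg_pairK : involutive neg_pair.
Proof. by case=> k b; rewrite /neg_pair/= negbK. Qed.

Section Hybrid.
Variables (s : nat) (xi B : R) (f : {ffun 'I_s -> T} -> R).
Hypothesis fxi : bounded_diff xi f.

Definition hyb (z : Z) (i : nat) : 'I_s -> T -> R := hybrid (fun=> P z) (fun=> q) i.

(** Left as a parameter because two bounds, linear and square-root in [s], are supplied for it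
    later, each giving one private term. Freezing the [i]-th sample at [x] leaves the law of the
    others. *)
Hypothesis hB : forall (i : 'I_s) (z : Z) (x : T),
  \sum_(X : {ffun 'I_s -> T})
    `|\prod_j replace (hyb z i) i (point_mass R x) j (X j) -
      \prod_j replace (hyb (flip_at x.1 z) i) i (point_mass R x) j (X j)| <= B.

(** The two symmetrisations gain a factor 4, and the [2 * m] frozen values of the [i]-th sample
    compensate the size [gam / (2 * m)] of the increment. *)
Lemma paninski_step (i : 'I_s) :
  `|\sum_z pexpect (replace (hyb z i) i (fun x => P z x - q x)) f| <=
  #|Z|%:R * (gam * xi * B / 4).
Proof.
have /andP[g0 g1] := gam01.
pose d z x := P z x - q x; pose W z X := \prod_(j | j != i) hyb z i j (X j).
pose iota := map_at i neg_pair.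
set S := \sum_z _.
pose A z := \sum_(X : {ffun 'I_s -> T}) d z (X i) * W z X * f X.
have SE : S = \sum_z A z.
  by apply: eq_bigr => z _; apply: eq_bigr => X _; rewrite prod_replace.
(* Swapping within the pair of the [i]-th sample negates [d] and fixes [W], so [f] may be replaced
   by half of [g]. *)
have step1 z : A z = - \sum_(X : {ffun 'I_s -> T}) d z (X i) * W z X * f (iota X).
  rewrite /A (reindex_inj (can_inj (map_atK i neg_pairK)))/= -sumrN.
  apply: eq_bigr => X _; rewrite map_at_eq.
  have -> : d z (neg_pair (X i)) = - d z (X i).
    by rewrite /d !paninskiB/= signrN; ring.
  have -> : W z (map_at i neg_pair X) = W z X.
    by apply: eq_bigr => j ji; rewrite map_at_neq.
  by rewrite /iota; ring.
pose g X := f X - f (iota X).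
(* Flipping the sign of that pair also negates [d], so [W] may be replaced by half of its difference
   under the flip. *)
have step2 (X : {ffun 'I_s -> T}) : \sum_z d z (X i) * W z X =
    - \sum_z d z (X i) * W (flip_at (X i).1 z) X.
  rewrite (reindex_inj (can_inj (flip_atK (X i).1)))/= -sumrN.
  apply: eq_bigr => z _.
  by rewrite /d !paninskiB ffunE eqxx signrN; ring.
have S4 : 4 * S = \sum_(X : {ffun 'I_s -> T})
    \sum_z d z (X i) * (W z X - W (flip_at (X i).1 z) X) * g X.
  transitivity (2 * \sum_(X : {ffun 'I_s -> T}) (\sum_z d z (X i) * W z X) * g X).
    have -> : \sum_(X : {ffun 'I_s -> T}) (\sum_z d z (X i) * W z X) * g X = 2 * S.
      have -> : 2 * S = \sum_z (A z + A z) by rewrite SE big_split/=; ring.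
      under [RHS]eq_bigr do rewrite {2}step1 -sumrB.
      rewrite [RHS]exchange_big/=; apply: eq_bigr => X _.
      by rewrite big_distrl/=; apply: eq_bigr => z _; rewrite /g; ring.
    by ring.
  rewrite big_distrr/=; apply: eq_bigr => X _.
  rewrite -big_distrl/= mulrA; congr (_ * _).
  under [RHS]eq_bigr do rewrite mulrBr.
  rewrite sumrB -[X in _ - X]opprK -step2; ring.
have dE z x : `|d z x| = gam / (2 * m).
  rewrite /d paninskiB !normrM !normr_sign !mulr1 gtr0_norm//.
  by rewrite gtr0_norm// invr_gt0 mulr_gt0.
have gxi X : `|g X| <= xi.
  rewrite /g; refine (fxi (i:=i) (X:=X) (X':=iota X) _) => j ji.
  by rewrite /iota map_at_neq.
have xi0 : 0 <= xi.
  have /card_gt0P[k _] := I_gt0.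
  exact: le_trans (normr_ge0 _) (gxi [ffun=> (k, true)]).
have bound : `|4 * S| <= gam / (2 * m) * xi *
    \sum_z \sum_(X : {ffun 'I_s -> T}) `|W z X - W (flip_at (X i).1 z) X|.
  rewrite S4 exchange_big/= big_distrr/=.
  apply: le_trans (ler_norm_sum _ _ _) _; apply: ler_sum => z _.
  apply: le_trans (ler_norm_sum _ _ _) _; rewrite big_distrr/=.
  apply: ler_sum => X _; rewrite !normrM dE -mulrA [`|_ - _| * _]mulrC mulrA.
  by rewrite ler_wpM2r// ler_wpM2l// divr_ge0 ?mulr_ge0// ltW.
have WB z : \sum_(X : {ffun 'I_s -> T}) `|W z X - W (flip_at (X i).1 z) X| <=
    2 * m * B.
  apply: (@le_trans _ _ (\sum_(x : T) B)); last first.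
    by rewrite sumr_const card_prod card_bool -[leLHS]mulr_natl natrM [_ * 2]mulrC.
  (* [W] ignores the [i]-th sample, so grouping the datasets by its value inserts a point mass
     there. *)
  have -> : \sum_(X : {ffun 'I_s -> T}) `|W z X - W (flip_at (X i).1 z) X| =
    \sum_x \sum_(X : {ffun 'I_s -> T})
    `|\prod_j replace (hyb z i) i (point_mass R x) j (X j) -
      \prod_j replace (hyb (flip_at x.1 z) i) i (point_mass R x) j (X j)|.
    rewrite exchange_big/=; apply: eq_bigr => X _.
    under [RHS]eq_bigr do rewrite !prod_replace -mulrBr normrM.
    rewrite (bigD1 (X i))//= [X in _ = _ + X]big1 => [|x /negbTE xX].
      by rewrite addr0 /point_mass eqxx normr1 mul1r.
    by rewrite /point_mass eq_sym xX normr0 mul0r.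
  by apply: ler_sum => x _; exact: hB.
have : `|4 * S| <= gam / (2 * m) * xi * (#|Z|%:R * (2 * m * B)).
  apply: le_trans bound _; apply: ler_wpM2l.
    by rewrite mulr_ge0// divr_ge0 ?mulr_ge0// ltW.
  apply: le_trans (ler_sum _ (fun z _ => WB z)) _.
  by rewrite sumr_const -[leLHS]mulr_natl.
rewrite normrM normr_nat.
have -> : gam / (2 * m) * xi * (#|Z|%:R * (2 * m * B)) =
  4 * (#|Z|%:R * (gam * xi * B / 4)) by field.
lra.
Qed.

(** The telescoping is done for each [z], but the sum over [z] is taken inside each step, where the
    cancellation happens. *)
Lemma paninski_hybrid :
  `|\sum_z #|Z|%:R^-1 * pexpect (fun=> P z) f - pexpect (fun=> q) f| <=
  s%:R * (gam * xi * B / 4).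
Proof.
have N0 : (0 : R) < #|Z|%:R.
  by rewrite ltr0n; apply/card_gt0P; exists [ffun=> true].
have -> : \sum_z #|Z|%:R^-1 * pexpect (fun=> P z) f - pexpect (fun=> q) f =
    #|Z|%:R^-1 * \sum_(i < s) \sum_z
      pexpect (replace (hyb z i) i (fun x => P z x - q x)) f.
  rewrite exchange_big/=.
  under [X in _ = _ * X]eq_bigr do rewrite -(pexpect_telescope (fun=> P _) (fun=> q)).
  rewrite sumrB mulrBr -big_distrr/= sumr_const -[in RHS](mulr_natl (pexpect _ _)).
  by rewrite mulKf// gt_eqF.
rewrite normrM ger0_norm ?invr_ge0 ?(ltW N0)// ler_pdivrMl//.
apply: le_trans (ler_norm_sum _ _ _) _.
apply: le_trans (ler_sum _ (fun i _ => paninski_step i)) _.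
by rewrite sumr_const card_ord -[leLHS]mulr_natl mulrCA.
Qed.

Let v (z : Z) (i : 'I_s) (x : T) : 'I_s -> T -> R :=
  replace (hyb z i) i (point_mass R x).

Lemma hyb_pmf (z : Z) k j : is_pmf (hyb z k j).
Proof.
by apply: hybrid_pmf => i; [exact: paninski_pmf|exact: unif_pmf].
Qed.

Let v_pmf z i x j : is_pmf (v z i x j).
Proof.
by apply: replace_pmf => [l|]; [exact: hyb_pmf|exact: point_mass_pmf].
Qed.

(** Only the samples before the [i]-th feel the flip, through one pair whose two masses each move by
    [gam / m]; a test bounded by 1 has differences at most 2. *)
Lemma paninski_l1_step_lin (i : 'I_s) (z : Z) (x : T) :
  \sum_(X : {ffun 'I_s -> T})
    `|\prod_j v z i x j (X j) - \prod_j v (flip_at x.1 z) i x j (X j)|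
  <= 4 * (s%:R * gam / m).
Proof.
have /andP[g0 g1] := gam01.
have [h h1 ->] := pexpect_l1 (v z i x) (v (flip_at x.1 z) i x).
have h2 : bounded_diff 2 h.
  move=> j X X' _; apply: le_trans (ler_normB _ _) _.
  by have := h1 X; have := h1 X'; lra.
apply: le_trans (ler_norm _) _.
apply: le_trans (pexpect_bounded_diff (v_pmf z i x) (v_pmf _ i x) h2) _.
have coord (j : 'I_s) :
    \sum_y `|v z i x j y - v (flip_at x.1 z) i x j y| <= 2 * (gam / m).
  have gm0 : 0 <= gam / m by rewrite divr_ge0 ?ltW.
  rewrite /v /replace /hyb /hybrid.
  case: eqP => _; last case: ifP => _.
  - by rewrite big1 ?(mulr_ge0 _ gm0)// => y _; rewrite subrr normr0.
  - rewrite sum_pairs (bigD1 x.1)//= [X in _ + X]big1 => [|k kx]; last first.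
      by rewrite /P /pert/= !ffunE (negbTE kx) !subrr !normr0 addr0.
    have dE b : `|P z (x.1, b) - P (flip_at x.1 z) (x.1, b)| = gam / m.
      rewrite (_ : _ - _ = (-1) ^+ b * (-1) ^+ z x.1 * (gam / m)).
        by rewrite 2!normrM !normr_sign !mul1r ger0_norm.
      by rewrite /P /pert/= !ffunE eqxx signrN -/m; field.
    by rewrite !dE addr0; lra.
  - by rewrite big1 ?(mulr_ge0 _ gm0)// => y _; rewrite subrr normr0.
apply: (@le_trans _ _ (2 * \sum_(j < s) (2 * (gam / m)))).
  by rewrite ler_wpM2l// ler_sum.
rewrite sumr_const card_ord -[_ *+ s]mulr_natl le_eqVlt; apply/orP; left.
by apply/eqP; ring.
Qed.

(** The reference distribution is unperturbed in the pair of [x], so that the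
    chi-squared divergence stays finite even for [gam = 1]. *)
Lemma paninski_near_mid (i : 'I_s) (z0 z : Z) (x : T) (h : {ffun 'I_s -> T} -> R) :
  (forall X, `|h X| <= 1) -> (forall l, l != x.1 -> z l = z0 l) ->
  (pexpect (v z i x) h -
   pexpect (replace (hybrid (fun=> pert (fun l => if l == x.1 then 0 else
     gam * (-1) ^+ z0 l)) (fun=> q) i) i (point_mass R x)) h) ^+ 2
  <= 8 * (s%:R * (gam ^+ 2 / m)).
Proof.
have /andP[g0 g1] := gam01.
move=> h1 zz0; set zeta := (fun l => if _ then _ else _).
set mid := replace _ _ _.
have zeta1 l : `|zeta l| <= 1.
  rewrite /zeta; case: eqP => _; first by rewrite normr0.
  by rewrite normrM normr_sign mulr1 ger0_norm// ltW.
have mid_pmf j : is_pmf (mid j).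
  apply: replace_pmf => [l|]; last exact: point_mass_pmf.
  by apply: hybrid_pmf => k; [exact: pert_pmf|exact: unif_pmf].
pose u (j : 'I_s) (y : T) :=
  if (j < i)%N && (y.1 == x.1) then gam * (-1) ^+ y.2 * (-1) ^+ z x.1 else 0.
have vE : pexpect (v z i x) h = pexpect (fun j y => mid j y * (1 + u j y)) h.
  apply: eq_pexpect => j y; rewrite /v /mid /replace /hyb /hybrid /u.
  case: eqP => [->|_]; first by rewrite ltnn addr0 mulr1.
  case: ifP => _ /=; last by rewrite addr0 mulr1.
  rewrite /P /pert /zeta -/m; case: eqP => [->|/eqP yx].
    by field.
  by rewrite zz0// addr0 mulr1.
rewrite vE; apply: pexpect_chi2 => //.
- move=> j y; rewrite /u; case: ifP => _; last by rewrite addr0.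
  by case: y.2; case: (z _); rewrite ?expr0 ?expr1; lra.
- move=> j; rewrite /mid /u /replace /hybrid.
  case: eqP => [->|_]; first by rewrite ltnn big1// => y _; rewrite mulr0.
  case: ifP => _ /=; last by rewrite big1// => y _; rewrite mulr0.
  rewrite sum_pairs big1// => k _; rewrite /pert /zeta/=.
  by case: eqP => _; rewrite ?expr0 ?expr1; ring.
- move=> j; rewrite /mid /u /replace /hybrid.
  have c0 : 0 <= gam ^+ 2 / m by rewrite divr_ge0 ?sqr_ge0 ?ltW.
  case: eqP => [->|_]; first by rewrite ltnn big1// => y _; rewrite expr0n mulr0.
  case: ifP => _ /=; last by rewrite big1// => y _; rewrite expr0n mulr0.
  rewrite sum_pairs (bigD1 x.1)//= [X in _ + X]big1 => [|k /negbTE kx].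
    rewrite eqxx !exprMn !sqrr_sign /pert /zeta/= eqxx -/m !mulr0 !mulr1.
    by rewrite addr0 le_eqVlt; apply/orP; left; apply/eqP; field.
  by rewrite kx expr0n !mulr0 addr0.
- by rewrite divr_ge0 ?sqr_ge0 ?ltW.
Qed.

(** Triangle inequality through the law unperturbed in the pair of [x], which is common to [z] and
    its flip. *)
Lemma paninski_l1_step_sqrt (i : 'I_s) (z : Z) (x : T) :
  \sum_(X : {ffun 'I_s -> T})
    `|\prod_j v z i x j (X j) - \prod_j v (flip_at x.1 z) i x j (X j)|
  <= 2 * Num.sqrt (8 * (s%:R * (gam ^+ 2 / m))).
Proof.
have [h h1 ->] := pexpect_l1 (v z i x) (v (flip_at x.1 z) i x).
have := @paninski_near_mid i z z x h h1 (fun _ _ => erefl).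
have zl l : l != x.1 -> flip_at x.1 z l = z l by rewrite ffunE => /negbTE ->.
have := @paninski_near_mid i z (flip_at x.1 z) x h h1 zl.
set mid := pexpect (replace (hybrid _ _ _) _ _) h.
move=> /ler_wsqrtr a1 /ler_wsqrtr a2; rewrite !sqrtr_sqr in a1 a2.
by move: a1 a2; rewrite !ler_norml => /andP[? ?] /andP[? ?]; lra.
Qed.

End Hybrid.

Lemma paninski_l1 z : \sum_x `|P z x - q x| = gam.
Proof.
have /andP[g0 g1] := gam01.
have dE x : `|P z x - q x| = gam / (2 * m).
  rewrite paninskiB !normrM !normr_sign !mulr1 gtr0_norm//.
  by rewrite gtr0_norm// invr_gt0 mulr_gt0.
under eq_bigr do rewrite dE.
rewrite sumr_const card_prod card_bool -[LHS]mulr_natl natrM -/m.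
by field.
Qed.

(** The mean of [f] drops by at least [1 / 5] from [q] to the mixture. In turn this is confronted
    with the chi-squared bound, the hybrid argument with the square-root and the linear distance
    bounds, and plain sample replacement for one [z]. *)
Lemma paninski_lower (s : nat) (xi : R) (f : {ffun 'I_s -> T} -> R) :
  0 <= xi -> (forall X, `|f X| <= 1) -> bounded_diff xi f ->
  2 / 5 <= pexpect (fun=> q) f -> (forall z, pexpect (fun=> P z) f <= 1 / 5) ->
  [/\ m <= 30 * (s%:R ^+ 2 * gam ^+ 4),
      m <= 50 * (s%:R ^+ 3 * gam ^+ 4 * xi ^+ 2),
      m <= 5 * (s%:R ^+ 2 * gam ^+ 2 * xi) &
      1 <= 5 * (s%:R * gam * xi)].
Proof.
move=> xi0 f1 fxi hq hP; have /andP[g0 g1] := gam01.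
have N0 : (0 : R) < #|Z|%:R.
  by rewrite ltr0n; apply/card_gt0P; exists [ffun=> true].
set D := \sum_z #|Z|%:R^-1 * pexpect (fun=> P z) f - pexpect (fun=> q) f.
have DE : D <= - (1 / 5).
  have : \sum_(z : Z) #|Z|%:R^-1 * pexpect (fun=> P z) f <= 1 / 5.
    apply: (@le_trans _ _ (\sum_(z : Z) #|Z|%:R^-1 * (1 / 5))).
      by apply: ler_sum => z _; rewrite ler_wpM2l// invr_ge0 ltW.
    by rewrite sumr_const -[_ *+ _]mulr_natl mulVKf// gt_eqF.
  by rewrite /D; lra.
have Dn : 1 / 5 <= `|D| by rewrite ler0_norm; lra.
split.
(* Otherwise the squared drop, at least [1 / 25], would be at most [1 / 29]. *)
- rewrite leNgt; apply/negP => /ltW hm.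
  by have := paninski_chi2 f1 hm; rewrite -/D => h; nra.
- have := paninski_hybrid fxi (@paninski_l1_step_sqrt s); rewrite -/D.
  set b := Num.sqrt _ => h.
  have b2 : b ^+ 2 = 8 * (s%:R * (gam ^+ 2 / m)).
    by rewrite sqr_sqrtr// !mulr_ge0 ?invr_ge0 ?sqr_ge0// ltW.
  have : (1 / 5) ^+ 2 <= (s%:R * gam * xi * b / 2) ^+ 2.
    have b0 : 0 <= b by exact: sqrtr_ge0.
    rewrite ler_sqr ?nnegrE ?divr_ge0 ?mulr_ge0 ?(ltW g0)//.
    by apply: le_trans Dn (le_trans h _); lra.
  rewrite !exprMn b2.
  have -> : s%:R ^+ 2 * gam ^+ 2 * xi ^+ 2 * (8 * (s%:R * (gam ^+ 2 / m))) * 2^-1 ^+ 2 =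
    2 * (s%:R ^+ 3 * gam ^+ 4 * xi ^+ 2) / m by field.
  by rewrite ler_pdivlMr//; lra.
- have := paninski_hybrid fxi (@paninski_l1_step_lin s); rewrite -/D => h.
  have := le_trans Dn h.
  have -> : s%:R * (gam * xi * (4 * (s%:R * gam / m)) / 4) =
    s%:R ^+ 2 * gam ^+ 2 * xi / m by field.
  by rewrite ler_pdivlMr//; lra.
- pose z : Z := [ffun=> true].
  have := pexpect_bounded_diff (fun=> paninski_pmf z) (fun=> unif_pmf) fxi.
  have := hP z; have := hq.
  set a := pexpect _ _; set c := pexpect _ _ => h1 h2 h3.
  have : 1 / 5 <= `|c - a| by rewrite ler0_norm; lra.
  move=> /le_trans/(_ h3); under eq_bigr do rewrite paninski_l1.
  by rewrite sumr_const card_ord -[_ *+ s]mulr_natl; lra.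
Qed.

End Paninski.

(** * Total variation and transport along injections *)

Definition fdist_of (R : realType) (T : finType) (w : T -> R) (hw : is_pmf w) :
  fdist R T := FDist (proj1 hw) (proj2 hw).

Lemma fdist_pmf (R : realType) (T : finType) (p : fdist R T) : is_pmf p.
Proof. by split; [exact: Defs.pmf_ge0|exact: Defs.pmf_sum1]. Qed.

Lemma dTV_le1 (R : realType) (T : finType) (p q : fdist R T) : dTV p q <= 1.
Proof.
rewrite dTV_half_l1 ler_pdivrMl// mulr1.
apply: (@le_trans _ _ (\sum_x (p x + q x))); last by rewrite big_split/= !Defs.pmf_sum1.
apply: ler_sum => x _; apply: le_trans (ler_normB _ _) _.
by rewrite !ger0_norm ?Defs.pmf_ge0.
Qed.

Lemma dTVxx (R : realType) (T : finType) (p : fdist R T) : dTV p p = 0.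
Proof. by rewrite dTV_half_l1 big1 ?mulr0// => x _; rewrite subrr normr0. Qed.

Lemma pexpect_dTV (R : realType) (T : finType) (s : nat) (K : R)
    (p q : fdist R T) (f : {ffun 'I_s -> T} -> R) :
  bounded_diff K f ->
  pexpect (fun=> q) f - pexpect (fun=> p) f <= 2 * (K * (s%:R * dTV p q)).
Proof.
move=> fK; apply: le_trans (ler_norm _) _; rewrite distrC.
apply: le_trans (pexpect_bounded_diff (fun=> fdist_pmf p) (fun=> fdist_pmf q) fK) _.
rewrite dTV_half_l1 sumr_const card_ord -[_ *+ s]mulr_natl.
by rewrite le_eqVlt; apply/orP; left; apply/eqP; field.
Qed.

Section Push.
Variables (R : realType) (T U : finType) (e : T -> U).
Hypothesis e_inj : injective e.

(** Carries instances built on convenient finite types to ['I_n]; points outside the image get an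
    empty sum. *)
Definition pushf (w : T -> R) (y : U) : R := \sum_(x | e x == y) w x.

Lemma pushf_pmf (w : T -> R) : is_pmf w -> is_pmf (pushf w).
Proof.
case=> w0 w1; split=> [y|]; first exact: sumr_ge0.
by rewrite -w1 [RHS](partition_big e predT).
Qed.

Definition push (p : fdist R T) : fdist R U := fdist_of (pushf_pmf (fdist_pmf p)).

Lemma dTV_push (p q : fdist R T) : dTV (push p) (push q) = dTV p q.
Proof.
rewrite !dTV_half_l1; congr (_ * _); rewrite [RHS](partition_big e predT)//=.
apply: eq_bigr => y _; rewrite /pushf -sumrB.
have [x /eqP <-|y0] := pickP (fun x => e x == y); last by rewrite !big_pred0 ?normr0.
have ex : (fun x' => e x' == e x) =1 pred1 x by move=> x'; exact: inj_eq.
by rewrite 2!(eq_bigl _ _ ex) !big_pred1_eq.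
Qed.

(** Group the datasets by their image: a product of fibre sums expands into a sum over preimages. *)
Lemma pexpect_push (s : nat) (p : fdist R T) (f : {ffun 'I_s -> U} -> R) :
  pexpect (fun=> push p) f =
  pexpect (fun=> p) (fun X : {ffun 'I_s -> T} => f [ffun i => e (X i)]).
Proof.
rewrite /pexpect [RHS](partition_big (fun X : {ffun 'I_s -> T} => [ffun i => e (X i)])
  predT)//=.
apply: eq_bigr => Y _; rewrite /pushf bigA_distr_big_dep/= big_distrl/=.
have eqY (X : {ffun 'I_s -> T}) : (X \in family (fun i x => e x == Y i)) =
    ([ffun i => e (X i)] == Y).
  apply/familyP/eqP => [h|<- i]; last by rewrite unfold_in ffunE.
  by apply/ffunP => i; rewrite ffunE; apply/eqP; exact: (h i).
by apply: eq_big => // X; rewrite eqY => /eqP <-.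
Qed.

End Push.

(** * Private testers on a finite sample space *)

(** What the lower bounds retain of a tester: [F v X] stands for the probability of the verdict [v]
    on [X]. The difference bound 1, valid for any probability, gives sample bounds free of [xi]. *)
Record tester_on (R : realType) (T : finType) (s : nat) (xi eps alpha : R)
    (q phat : fdist R T) (F : verdict -> {ffun 'I_s -> T} -> R) : Prop := TesterOn {
  tester_norm : forall v X, `|F v X| <= 1 ;
  tester_dp : forall v, bounded_diff xi (F v) ;
  tester_diff1 : forall v, bounded_diff 1 (F v) ;
  tester_reject : pexpect (fun=> q) (F Reject) <= 1 / 5 ;
  tester_total : pexpect (fun=> q) (F Accept) + pexpect (fun=> q) (F Reject) +
    pexpect (fun=> q) (F Bot) = 1 ;
  tester_accept : forall p : fdist R T, eps < dTV p q ->
    pexpect (fun=> p) (F Accept) <= 1 / 5 ;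
  tester_bot : forall p : fdist R T, dTV p phat <= alpha ->
    pexpect (fun=> p) (F Bot) <= 1 / 5 }.

Lemma sum_verdict (R : realType) (F : verdict -> R) :
  \sum_v F v = F Accept + F Reject + F Bot.
Proof.
rewrite (bigD1 Accept)// (bigD1 Reject)/=; last exact/eqP.
rewrite (bigD1 Bot)/=; last by apply/andP; split; exact/eqP.
by rewrite big1 ?addr0 ?addrA//; case; rewrite eqxx ?andbF.
Qed.

(** [a - b <= a * (1 - expR (- xi)) <= xi] since [a <= 1], and symmetrically. *)
Lemma dp_dist (R : realType) (xi a b : R) : 0 < xi -> 0 <= a <= 1 -> 0 <= b <= 1 ->
  a <= expR xi * b -> b <= expR xi * a -> `|a - b| <= xi.
Proof.
move=> xi0 /andP[a0 a1] /andP[b0 b1].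
have E (x y : R) : 0 <= x -> x <= 1 -> x <= expR xi * y -> x - y <= xi.
  move=> x0 x1 xy; have : expR (- xi) * x <= y by rewrite expRN ler_pdivrMl ?expR_gt0.
  by have := expR_ge1Dx (- xi); nra.
by move=> ab ba; rewrite ler_norml; have := E a b a0 a1 ab; have := E b a b0 b1 ba; lra.
Qed.

(** Injective relabelling preserves Hamming and total variation distances, so privacy and the
    guarantees carry over. *)
Lemma tester_pull (R : realType) (T : finType) (n s : nat) (e : T -> 'I_n)
    (xi eps alpha : R) (q phat : fdist R T) (A : algorithm R n s) :
  injective e -> 0 < xi -> dp xi A ->
  augmented_tester (push e q) (push e phat) eps alpha (1 / 5) A ->
  tester_on xi eps alpha q phat (fun v X => A [ffun i => e (X i)] v).
Proof.
move=> e_inj xi0 hdp hA.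
have vE (p : fdist R T) v : pexpect (fun=> p) (fun X => A [ffun i => e (X i)] v) =
    verdict_prob A (push e p) v.
  by rewrite -(pexpect_push e p (fun X => A X v)).
have A01 Y v : 0 <= A Y v <= 1.
  rewrite Defs.pmf_ge0/= -(Defs.pmf_sum1 (A Y)) (bigD1 v)//= lerDl.
  by apply: sumr_ge0 => *; exact: Defs.pmf_ge0.
split.
- by move=> v X; have /andP[a0 a1] := A01 [ffun i => e (X i)] v; rewrite ger0_norm.
- move=> v i X X' XX'.
  (* Privacy concerns Hamming distance exactly 1, whereas [bounded_diff] also allows equal
     datasets. *)
  have [XX'i|neq] := eqVneq (X i) (X' i).
    have -> : X = X' by apply/ffunP => j; have [->|/XX'] := eqVneq j i.
    by rewrite subrr normr0 ltW.
  have PE Y : Prob (A Y) [set v] = A Y v by rewrite /Prob big_set1.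
  have H Y Y' : (forall j, j != i -> Y j = Y' j) -> Y i != Y' i ->
      A [ffun i => e (Y i)] v <= expR xi * A [ffun i => e (Y' i)] v.
    move=> YY' Yi; rewrite -!PE; apply: hdp; rewrite /Ham.
    rewrite (_ : [set _ | _] = [set i]) ?cards1//; apply/setP => j.
    rewrite !inE !ffunE (inj_eq e_inj); have [->//|ji] := eqVneq j i.
    by rewrite YY' ?eqxx.
  apply: dp_dist; rewrite ?A01//; apply: H => //; last by rewrite eq_sym.
  by move=> j /XX'.
- move=> v i X X' _; have := A01 [ffun i => e (X i)] v.
  have := A01 [ffun i => e (X' i)] v.
  by rewrite ler_norml => /andP[? ?] /andP[? ?]; lra.
- by rewrite vE; case: (hA (push e q)) => + _ _; apply.
- rewrite /pexpect -!big_split/= -[RHS](sum_prod_pmf (fun _ : 'I_s => fdist_pmf q)).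
  apply: eq_bigr => X _; rewrite -!mulrDr -(sum_verdict (A _)).
  by rewrite Defs.pmf_sum1 mulr1.
- move=> p pq; rewrite vE; case: (hA (push e p)) => _ + _; apply.
  by rewrite dTV_push.
- move=> p pq; rewrite vE; case: (hA (push e p)) => _ _; apply.
  by rewrite dTV_push.
Qed.

Lemma tester_cases (R : realType) (T : finType) (s : nat) (xi eps alpha : R)
    (q phat : fdist R T) (F : verdict -> {ffun 'I_s -> T} -> R) :
  tester_on xi eps alpha q phat F ->
  2 / 5 <= pexpect (fun=> q) (F Accept) \/ 2 / 5 <= pexpect (fun=> q) (F Bot).
Proof.
case=> _ _ _ h1 h2 _ _.
have [|h3] := lerP (2 / 5) (pexpect (fun=> q) (F Accept)); first by left.
by right; lra.
Qed.

(** Total variation never exceeds 1, so replacing all samples must cost at least the drop [1 / 5];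
    for [Bot] the witness is [phat] itself. *)
Lemma tester_trivial_lower (R : realType) (T : finType) (s : nat)
    (xi eps alpha : R) (q phat p : fdist R T)
    (F : verdict -> {ffun 'I_s -> T} -> R) :
  0 <= alpha -> 0 < xi -> tester_on xi eps alpha q phat F -> eps < dTV p q ->
  (1 : R) <= 10 * s%:R /\ 1 <= 10 * (s%:R * xi).
Proof.
move=> al0 xi0 tF pq.
have H (K : R) (p' : fdist R T) (v : verdict) : 0 <= K -> bounded_diff K (F v) ->
    2 / 5 <= pexpect (fun=> q) (F v) -> pexpect (fun=> p') (F v) <= 1 / 5 ->
    1 <= 10 * (s%:R * K).
  move=> K0 fK h1 h2; have h3 := pexpect_dTV p' q fK.
  have : K * (s%:R * dTV p' q) <= K * s%:R.
    by rewrite ler_wpM2l// ler_piMr// dTV_le1.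
  lra.
have [hq|hq] := tester_cases tF.
  have hp := tester_accept tF pq.
  by split; [rewrite -[s%:R]mulr1; apply: H (tester_diff1 tF _) hq hp|
    apply: H (tester_dp tF _) hq hp];
    rewrite ?ltW.
have hp : pexpect (fun=> phat) (F Bot) <= 1 / 5.
  by apply: (tester_bot tF); rewrite dTVxx.
by split; [rewrite -[s%:R]mulr1; apply: H (tester_diff1 tF _) hq hp|
    apply: H (tester_dp tF _) hq hp];
  rewrite ?ltW.
Qed.

(** * Tilts of the reference and the prediction rate *)

Section Tilt.
Variables (R : realType) (T : finType) (q : fdist R T) (u : T -> R).
Hypotheses (u_ge : forall x, 0 <= 1 + u x) (u_mean : \sum_x q x * u x = 0)
  (u_norm : \sum_x q x * `|u x| = 3 / 2) (u_var : \sum_x q x * u x ^+ 2 <= 5).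

Lemma tilt_pmf (l : R) : 0 <= l <= 1 -> is_pmf (fun x => q x * (1 + l * u x)).
Proof.
case/andP=> l0 l1; split=> [x|].
  rewrite mulr_ge0 ?Defs.pmf_ge0//.
  have -> : 1 + l * u x = (1 - l) + l * (1 + u x) by ring.
  by rewrite addr_ge0 ?mulr_ge0 ?subr_ge0.
under eq_bigr => x _ do rewrite mulrDr mulr1 mulrCA.
by rewrite big_split/= -big_distrr/= u_mean mulr0 addr0 Defs.pmf_sum1.
Qed.

(** A segment issuing from [q], at distance [3 / 4 * l] from it; distances up to [3 / 4] are
    reached. *)
Definition tilt (l : R) (hl : 0 <= l <= 1) : fdist R T := fdist_of (tilt_pmf hl).

Lemma dTV_tilt (l l' : R) (hl : 0 <= l <= 1) (hl' : 0 <= l' <= 1) :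
  dTV (tilt hl) (tilt hl') = 3 / 4 * `|l - l'|.
Proof.
rewrite dTV_half_l1.
have -> : \sum_x `|tilt hl x - tilt hl' x| = `|l - l'| * (3 / 2).
  rewrite -u_norm big_distrr/=; apply: eq_bigr => x _.
  rewrite -[q x in RHS]ger0_norm ?Defs.pmf_ge0// -!normrM; congr (`| _ |); ring.
by field.
Qed.

Lemma dTV_tilt0 (l : R) (hl : 0 <= l <= 1) : dTV (tilt hl) q = 3 / 4 * l.
Proof.
have h0 : 0 <= (0 : R) <= 1 by rewrite lexx ler01.
have /andP[l0 _] := hl.
rewrite -[l in RHS]subr0 -[l - 0]ger0_norm ?subr0// -[l in RHS]subr0.
rewrite -(dTV_tilt hl h0) !dTV_half_l1; congr (_ * _).
by apply: eq_bigr => x _ /=; rewrite mul0r addr0 mulr1.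
Qed.

(** The chi-squared bound gives [1 / 25 <= 40 * s * l ^+ 2], and sample replacement gives
    [1 / 5 <= 3 / 2 * s * l * xi]. *)
Lemma tilt_lower (s : nat) (xi l : R) (f : {ffun 'I_s -> T} -> R)
    (hl : 0 <= l <= 1) :
  (forall X, `|f X| <= 1) -> bounded_diff xi f ->
  2 / 5 <= pexpect (fun=> q) f -> pexpect (fun=> tilt hl) f <= 1 / 5 ->
  1 <= 1000 * (s%:R * l ^+ 2) /\ 1 <= 10 * (s%:R * l * xi).
Proof.
move=> f1 fxi h1 h2; have /andP[l0 l1] := hl; split; last first.
  have := pexpect_dTV (tilt hl) q fxi; rewrite dTV_tilt0 => h3.
  have : 1 / 5 <= 2 * (xi * (s%:R * (3 / 4 * l))) by lra.
  have := ler0n R s; nra.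
have : (pexpect (fun=> tilt hl) f - pexpect (fun=> q) f) ^+ 2 <=
    8 * (s%:R * (l ^+ 2 * 5)).
  apply: (@pexpect_chi2 _ _ _ (fun=> q) (fun _ x => l * u x)) => //.
  - by move=> _; exact: fdist_pmf.
  - move=> _ x; have -> : 1 + l * u x = (1 - l) + l * (1 + u x) by ring.
    by rewrite addr_ge0 ?mulr_ge0 ?subr_ge0.
  - move=> _; under eq_bigr do rewrite mulrCA.
    by rewrite -big_distrr/= u_mean mulr0.
  - move=> _; under eq_bigr do rewrite exprMn mulrCA.
    by rewrite -big_distrr/= ler_wpM2l ?sqr_ge0.
  - by rewrite mulr_ge0 ?sqr_ge0.
set a := pexpect _ _ in h2 *; set b := pexpect _ _ in h1 *; nra.
Qed.

Lemma tester_bot_lower (s : nat) (xi eps alpha eta : R)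
    (heta : 0 <= eta / (3 / 4) <= 1) (F : verdict -> {ffun 'I_s -> T} -> R) :
  0 < xi -> 0 <= alpha < eta -> tester_on xi eps alpha q (tilt heta) F ->
  2 / 5 <= pexpect (fun=> q) (F Bot) ->
  1 / (eta - alpha) ^+ 2 + 1 / (xi * (eta - alpha)) <= 2000 * s%:R.
Proof.
move=> xi0 /andP[al0 aleta] tF hq.
have /andP[_ eta1] := heta.
have g0 : 0 < eta - alpha by rewrite subr_gt0.
have hl : 0 <= (eta - alpha) / (3 / 4) <= 1 by apply/andP; split; lra.
have hp : pexpect (fun=> tilt hl) (F Bot) <= 1 / 5.
  apply: (tester_bot tF); rewrite dTV_tilt.
  have -> : (eta - alpha) / (3 / 4) - eta / (3 / 4) = - (alpha / (3 / 4)) by field.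
  by rewrite normrN ger0_norm; lra.
have [h1 h2] := tilt_lower (tester_norm tF _) (tester_dp tF _) hq hp.
set g := eta - alpha in g0 h1 h2 *.
have e1 : 1 / g ^+ 2 <= 1800 * s%:R.
  rewrite ler_pdivrMr ?exprn_gt0//; apply: le_trans h1 _.
  rewrite exprMn; have := sqr_ge0 g; have := ler0n R s; nra.
have e2 : 1 / (xi * g) <= 20 * s%:R.
  rewrite ler_pdivrMr ?mulr_gt0//; apply: le_trans h2 _.
  have := ler0n R s; have : 0 < xi * g by exact: mulr_gt0.
  nra.
have := ler0n R s; lra.
Qed.

End Tilt.

(** * From polynomial inequalities to the identity rate *)

(** For [m] of order [n] and [gam] of order [eps], solving each inequality for [S] gives the term of
    the identity rate in the same position. *)
Definition identity_lower (R : realType) (C m S gam xi : R) : Prop :=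
  [/\ m <= C ^+ 2 * (S ^+ 2 * gam ^+ 4),
      m <= C ^+ 2 * (S ^+ 3 * gam ^+ 4 * xi ^+ 2),
      m <= C ^+ 2 * (S ^+ 2 * gam ^+ 2 * xi) &
      1 <= C * (S * gam * xi)].

Lemma sqrt_le_sqr (R : realType) (a b : R) : 0 <= b -> a <= b ^+ 2 -> Num.sqrt a <= b.
Proof.
by move=> b0 /ler_wsqrtr; rewrite sqrtr_sqr ger0_norm.
Qed.

Lemma powR_third (R : realType) (a : R) (k : nat) :
  0 < a -> (a `^ (k%:R / 3)) ^+ 3 = a ^+ k.
Proof.
move=> a0; rewrite -powR_mulrn ?powR_ge0// -powRrM divfK// powR_mulrn//.
exact: ltW.
Qed.

(** Taking powers removes the roots; the four terms cost 32, 2, 8 and 4 times [C * S]. *)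
Lemma identity_terms_le (R : realType) (n : nat) (C eps xi S gam m : R) :
  1000 <= C ->
  (0 < n)%N -> n%:R <= 4 * m -> 0 < eps -> 0 < xi -> 0 <= S ->
  0 < gam <= 4 * eps -> identity_lower C m S gam xi ->
  Num.sqrt n%:R / eps ^+ 2
   + n%:R `^ (1 / 3) / (eps `^ (4 / 3) * xi `^ (2 / 3))
   + Num.sqrt n%:R / (eps * Num.sqrt xi)
   + 1 / (eps * xi) <= 50 * C * S.
Proof.
move=> C1 n0 nm e0 x0 S0 /andP[g0 g4] [h1 h2 h3 h4].
have [eps0 gam0 xi0] := And3 (ltW e0) (ltW g0) (ltW x0).
have C0 : 0 <= C by lra.
have G2 : gam ^+ 2 <= 16 * eps ^+ 2.
  have -> : 16 * eps ^+ 2 = (4 * eps) ^+ 2 by ring.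
  by rewrite lerXn2r ?nnegrE ?mulr_ge0.
have G4 : gam ^+ 4 <= 256 * eps ^+ 4.
  have -> : 256 * eps ^+ 4 = (4 * eps) ^+ 4 by ring.
  by rewrite lerXn2r ?nnegrE ?mulr_ge0.
have t1 : Num.sqrt n%:R / eps ^+ 2 <= 32 * C * S.
  rewrite ler_pdivrMr ?exprn_gt0//; apply: sqrt_le_sqr.
    by rewrite !mulr_ge0 ?exprn_ge0.
  have : S ^+ 2 * gam ^+ 4 <= S ^+ 2 * (256 * eps ^+ 4) by rewrite ler_wpM2l ?sqr_ge0.
  have -> : (32 * C * S * eps ^+ 2) ^+ 2 =
    4 * (C ^+ 2 * (S ^+ 2 * (256 * eps ^+ 4))) by ring.
  by move=> /(ler_wpM2l (exprn_ge0 2 C0)); move: h1; lra.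
(* The cubed target carries [C ^+ 3] against [C ^+ 2] in the hypothesis; the spare [C / 32 >= 4]
   absorbs the 4 of [n <= 4 * m]. *)
have t2 : n%:R `^ (1 / 3) / (eps `^ (4 / 3) * xi `^ (2 / 3)) <= 2 * C * S.
  rewrite -(@ler_pXn2r _ 3) ?nnegrE ?divr_ge0 ?mulr_ge0 ?powR_ge0//.
  rewrite expr_div_n exprMn -[1 / 3]/(1%:R / 3) !powR_third ?ltr0n// expr1.
  rewrite ler_pdivrMr ?mulr_gt0 ?exprn_gt0//.
  have : S ^+ 3 * gam ^+ 4 * xi ^+ 2 <= S ^+ 3 * (256 * eps ^+ 4) * xi ^+ 2.
    by rewrite ler_wpM2r ?sqr_ge0// ler_wpM2l ?exprn_ge0.
  set Y := S ^+ 3 * (256 * eps ^+ 4) * xi ^+ 2.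
  have Y0 : 0 <= Y by rewrite !mulr_ge0 ?exprn_ge0.
  have -> : (2 * C * S) ^+ 3 * (eps ^+ 4 * xi ^+ 2) = C / 32 * (C ^+ 2 * Y).
    by rewrite /Y; field.
  have CY0 : 0 <= C ^+ 2 * Y by rewrite mulr_ge0 ?exprn_ge0.
  move=> /(ler_wpM2l (exprn_ge0 2 C0)) YC.
  have : 4 * (C ^+ 2 * Y) <= C / 32 * (C ^+ 2 * Y) by rewrite ler_wpM2r//; lra.
  by move: h2 YC; lra.
have t3 : Num.sqrt n%:R / (eps * Num.sqrt xi) <= 8 * C * S.
  rewrite ler_pdivrMr ?mulr_gt0 ?sqrtr_gt0//; apply: sqrt_le_sqr.
    by rewrite !mulr_ge0 ?sqrtr_ge0.
  have -> : (8 * C * S * (eps * Num.sqrt xi)) ^+ 2 =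
      4 * (C ^+ 2 * (S ^+ 2 * (16 * eps ^+ 2) * xi)).
    by rewrite !exprMn sqr_sqrtr//; ring.
  have : S ^+ 2 * gam ^+ 2 * xi <= S ^+ 2 * (16 * eps ^+ 2) * xi.
    by rewrite ler_wpM2r// ler_wpM2l ?sqr_ge0.
  by move=> /(ler_wpM2l (exprn_ge0 2 C0)); move: h3; lra.
have t4 : 1 / (eps * xi) <= 4 * C * S.
  rewrite ler_pdivrMr ?mulr_gt0//; apply: le_trans h4 _.
  have : S * gam * xi <= S * (4 * eps) * xi by rewrite ler_wpM2r// ler_wpM2l.
  by move=> /(ler_wpM2l C0); lra.
have : 0 <= C * S by rewrite mulr_ge0.
lra.
Qed.

Lemma identity_rate_le (R : realType) (n : nat) (C eps xi m S : R) :
  1000 <= C ->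
  (0 < n)%N -> n%:R <= 4 * m -> 0 <= eps < 1 / 2 -> 0 < xi -> 1 <= m -> 0 <= S ->
  (forall gam, 2 * eps < gam <= 1 -> identity_lower C m S gam xi) ->
  (((50 * C)^-1)%:E * identity_rate n eps xi <= S%:E)%E.
Proof.
move=> C1 n0 nm /andP[e0 e1] x0 m1 S0 H; rewrite /identity_rate.
have [ez|enz] := eqVneq eps 0.
  (* The rate is infinite, so a contradiction is needed: [gam] may be arbitrarily small, and this
     value violates the first inequality as [1 <= m]. *)
  have g0 : 0 < (C * (S + 1))^-1 by rewrite invr_gt0; nra.
  have [|h _ _ _] := H (C * (S + 1))^-1.
    rewrite ez mulr0 g0/= invf_le1; nra.
  exfalso; set gam := _^-1 in g0 h.
  have gE : C * gam * (S + 1) = 1 by rewrite /gam; field; apply/andP; split; lra.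
  have Cg0 : 0 <= C * gam by rewrite mulr_ge0; lra.
  have CSg0 : 0 <= C * gam * S by rewrite mulr_ge0.
  have Cg1 : C * gam <= 1 by lra.
  have g1 : gam < 1 by nra.
  have CS2 : (C * gam * S) ^+ 2 <= 1 by rewrite expr_le1//; lra.
  have g2 : gam ^+ 2 < 1 by rewrite expr_lt1//; lra.
  have E : C ^+ 2 * (S ^+ 2 * gam ^+ 4) = (C * gam * S) ^+ 2 * gam ^+ 2 by ring.
  have : (C * gam * S) ^+ 2 * gam ^+ 2 <= gam ^+ 2 by rewrite ler_piMl ?sqr_ge0.
  by move: h; rewrite E; lra.
have ep : 0 < eps by rewrite lt0r enz.
rewrite -EFinM lee_fin ler_pdivrMl; last lra.
(* [gam] is the minimum of [4 * eps] and 1, which exceeds [2 * eps] because [0 < eps < 1 / 2]. *)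
have [le4|gt4] := lerP (4 * eps) 1.
  apply: (@identity_terms_le _ _ C _ _ _ (4 * eps) m) => //; first by apply/andP; split; lra.
  by apply: H; apply/andP; split; lra.
apply: (@identity_terms_le _ _ C _ _ _ 1 m) => //; first by apply/andP; split; lra.
by apply: H; apply/andP; split; lra.
Qed.

Lemma min_rate_le (R : realType) (c S a : R) (b : \bar R) : 0 < c ->
  c * a <= S \/ (c%:E * b <= S%:E)%E -> (c%:E * Order.min a%:E b <= S%:E)%E.
Proof.
move=> c0; have E (y : \bar R) : (Order.min a%:E b <= y)%E ->
    (c%:E * y <= S%:E)%E -> (c%:E * Order.min a%:E b <= S%:E)%E.
  by move=> ay; apply: le_trans; apply: lee_wpmul2l => //; rewrite lee_fin ltW.
by case=> [h|]; [apply: (E a%:E)|apply: E]; rewrite ?ge_min ?lexx ?orbT.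
Qed.

(** * Hard pairs of reference and prediction *)

Definition bern (R : realType) (t : R) (b : bool) : R := if b then 1 - t else t.

Lemma bern_pmf (R : realType) (t : R) : 0 <= t <= 1 -> is_pmf (bern t).
Proof.
case/andP=> t0 t1; split=> [[]|]; rewrite /bern ?subr_ge0//.
by rewrite big_bool /= subrK.
Qed.

Definition fbern (R : realType) (t : R) (ht : 0 <= t <= 1) : fdist R bool :=
  fdist_of (bern_pmf ht).

Lemma dTV_bern (R : realType) (a b : R) (ha : 0 <= a <= 1) (hb : 0 <= b <= 1) :
  dTV (fbern ha) (fbern hb) = `|a - b|.
Proof.
rewrite dTV_half_l1 big_bool/= [X in `|X| + _](_ : _ = - (a - b)); last by ring.
by rewrite normrN; field.
Qed.

Lemma card_le_inj (T : finType) (n : nat) :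
  (#|T| <= n)%N -> exists e : T -> 'I_n, injective e.
Proof.
move=> le; exists (fun x => widen_ord le (enum_rank x)) => x y /(congr1 val)/= h.
by apply: enum_rank_inj; apply: val_inj.
Qed.

Definition hard_instance (R : realType) (C : R) (n : nat)
    (eps alpha xi eta : R) (q phat : fdist R 'I_n) : Prop :=
  dTV q phat = eta /\
  forall (s : nat) (A : algorithm R n s),
    dp xi A -> augmented_tester q phat eps alpha (1 / 5) A ->
    (((50 * C)^-1)%:E * Order.min (prediction_rate (eta - alpha) xi)%:E
                                  (identity_rate n eps xi) <= s%:R%:E)%E.

(** Two points allow every [eta] up to 1 and a witness at distance 1 from [q]; the prediction rate
    is at most [256 + 16 / xi]. *)
Lemma large_gap_instance (R : realType) (C : R) (n : nat) (eps alpha xi eta : R) :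
  1000 <= C -> (2 <= n)%N -> 0 <= eps < 1 / 2 -> 0 <= alpha -> 0 < xi ->
  alpha + 1 / 16 <= eta <= 1 ->
  exists q phat : fdist R 'I_n, hard_instance C eps alpha xi eta q phat.
Proof.
move=> C1 n2 /andP[e0 e1] al0 xi0 /andP[gap eta1].
have [e e_inj] : exists e : bool -> 'I_n, injective e.
  by apply: card_le_inj; rewrite card_bool.
have h0 : 0 <= (0 : R) <= 1 by rewrite lexx ler01.
have h1 : 0 <= (1 : R) <= 1 by rewrite lexx ler01.
have heta : 0 <= eta <= 1 by apply/andP; split; lra.
exists (push e (fbern h0)), (push e (fbern heta)); split.
  by rewrite dTV_push// dTV_bern sub0r normrN ger0_norm; case/andP: heta.
move=> s A hdp hA; have tA := tester_pull e_inj xi0 hdp hA.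
have far : eps < dTV (fbern h1) (fbern h0).
  by rewrite dTV_bern subr0 normr1; lra.
have [s1 s2] := tester_trivial_lower al0 xi0 tA far.
apply: min_rate_le; first by rewrite invr_gt0; lra.
left; rewrite ler_pdivrMl; last lra.
rewrite /prediction_rate; set g := eta - alpha.
have g1 : 1 / 16 <= g by rewrite /g; lra.
have t1 : 1 / g ^+ 2 <= 2560 * s%:R.
  rewrite ler_pdivrMr ?exprn_gt0//; last lra.
  have : (1 / 16) ^+ 2 <= g ^+ 2 by rewrite lerXn2r ?nnegrE; lra.
  have := ler0n R s; nra.
have t2 : 1 / (xi * g) <= 160 * s%:R.
  rewrite ler_pdivrMr ?mulr_gt0//; last lra.
  have : 0 <= s%:R * xi by lra.
  nra.
have := ler0n R s; nra.
Qed.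

(** [u] is normalised so that [q * (1 + l * u)] is at distance [3 l / 4] from [q]. *)
Lemma tilt_instance (R : realType) (C : R) (n : nat) (T : finType)
    (q : fdist R T) (u : T -> R) (m eps alpha xi eta : R) :
  1000 <= C -> (2 <= n)%N -> 0 <= eps < 1 / 2 -> 0 <= alpha < eta -> 0 < xi ->
  eta <= 3 / 4 -> (#|T| <= n)%N -> n%:R <= 4 * m -> 1 <= m ->
  (forall x, 0 <= 1 + u x) -> \sum_x q x * u x = 0 ->
  \sum_x q x * `|u x| = 3 / 2 -> \sum_x q x * u x ^+ 2 <= 5 ->
  (forall (s : nat) (gam : R) (f : {ffun 'I_s -> T} -> R),
    2 * eps < gam <= 1 -> (forall X, `|f X| <= 1) -> bounded_diff xi f ->
    2 / 5 <= pexpect (fun=> q) f ->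
    (forall p : fdist R T, dTV p q = gam / 2 -> pexpect (fun=> p) f <= 1 / 5) ->
    identity_lower C m s%:R gam xi) ->
  exists q phat : fdist R 'I_n, hard_instance C eps alpha xi eta q phat.
Proof.
move=> C1 n2 he hal xi0 eta34 Tn nm m1 u1 u2 u3 u4 hard.
have [e e_inj] := card_le_inj Tn.
have /andP[al0 aleta] := hal.
have heta : 0 <= eta / (3 / 4) <= 1 by apply/andP; split; lra.
exists (push e q), (push e (tilt u1 u2 heta)); split.
  have dC (p r : fdist R T) : dTV p r = dTV r p.
    by rewrite !dTV_half_l1; under eq_bigr do rewrite distrC.
  by rewrite dTV_push// dC dTV_tilt0//; field.
move=> s A hdp hA; have tA := tester_pull e_inj xi0 hdp hA.
apply: min_rate_le; first by rewrite invr_gt0; lra.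
have [hacc|hbot] := tester_cases tA.
  right; apply: (@identity_rate_le _ n C eps xi m) => //; first exact: ltnW.
  move=> gam hg; apply: (hard _ _ _ hg (tester_norm tA Accept) (tester_dp tA Accept) hacc).
  move=> p pq; apply: (tester_accept tA); rewrite pq.
  by case/andP: hg; lra.
left; rewrite ler_pdivrMl; last lra.
have := tester_bot_lower u3 u4 xi0 hal tA hbot.
rewrite /prediction_rate; have := ler0n R s; nra.
Qed.

(** Here [u] is 3 on mass [1 / 4] and -1 on mass [3 / 4], so tilts of one [q] serve both verdicts,
    and [n < 4] allows [m = 1]. *)
Lemma two_point_instance (R : realType) (C : R) (n : nat) (eps alpha xi eta : R) :
  1000 <= C -> (2 <= n < 4)%N -> 0 <= eps < 1 / 2 -> 0 <= alpha < eta -> 0 < xi ->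
  eta <= 3 / 4 ->
  exists q phat : fdist R 'I_n, hard_instance C eps alpha xi eta q phat.
Proof.
move=> C1 /andP[n2 n4] he hal xi0 eta34.
have h4 : 0 <= (1 / 4 : R) <= 1 by apply/andP; split; lra.
pose u (b : bool) : R := if b then -1 else 3.
have u1 b : 0 <= 1 + u b by case: b => /=; lra.
have u2 : \sum_b fbern h4 b * u b = 0 by rewrite big_bool/= /u; field.
have u3 : \sum_b fbern h4 b * `|u b| = 3 / 2.
  by rewrite big_bool/= /u normrN normr1 ger0_norm//; field.
have u4 : \sum_b fbern h4 b * u b ^+ 2 <= 5 by rewrite big_bool/= /u; lra.
apply: (@tilt_instance _ C n bool (fbern h4) u 1) => //.
- by rewrite card_bool.
- by rewrite mulr1 (ler_nat _ _ 4) ltnW.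
move=> s gam f /andP[eg g1] f1 fxi hq hp.
have g0 : 0 < gam by case/andP: he; lra.
have hl : 0 <= gam / 2 / (3 / 4) <= 1 by apply/andP; split; lra.
have hpl : pexpect (fun=> tilt u1 u2 hl) f <= 1 / 5.
  by apply: hp; rewrite dTV_tilt0//; field.
have [a1 a2] := tilt_lower u3 u4 f1 fxi hq hpl.
have S0 := ler0n R s.
set S : R := s%:R in S0 a1 a2 *.
(* The right-hand sides to bound are [(C * d) ^+ 2], [d * (C * t) ^+ 2], a quantity at least
   [C * d * (C * t)], and [C * t]. *)
set d := S * gam ^+ 2; have d1 : 1 <= 1000 * d.
  move: a1; rewrite /d !exprMn; have : 0 <= S * gam ^+ 2 by rewrite mulr_ge0 ?sqr_ge0.
  lra.
have t0 : 0 <= S * gam * xi by rewrite !mulr_ge0 ?(ltW xi0) ?(ltW g0).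
set t := S * gam * xi in t0; have t1 : 1 <= 10 * t by move: a2; rewrite /t; lra.
have Ct : 100 <= C * t by nra.
have Cd : 1 <= C * d by nra.
split; last by apply: le_trans Ct; lra.
- have -> : C ^+ 2 * (S ^+ 2 * gam ^+ 4) = (C * d) ^+ 2 by rewrite /d; ring.
  by rewrite exprn_ege1.
- have -> : C ^+ 2 * (S ^+ 3 * gam ^+ 4 * xi ^+ 2) = d * (C * t) ^+ 2.
    by rewrite /d /t; ring.
  have : 100 ^+ 2 <= (C * t) ^+ 2 by rewrite lerXn2r ?nnegrE//; lra.
  by nra.
- have -> : C ^+ 2 * (S ^+ 2 * gam ^+ 2 * xi) = (C * (S * gam)) * (C * t).
    by rewrite /t; ring.
  have dS : d <= S * gam by rewrite /d expr2 mulrA ler_piMr// mulr_ge0// ltW.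
  have CS : 1 <= C * (S * gam) by apply: le_trans Cd _; rewrite ler_wpM2l//; lra.
  nra.
Qed.

(** The support consists of [n %/ 4] quadruples: it fits in [n] points, its [m = 2 * (n %/ 4)] pairs
    satisfy [n <= 4 * m], and one point per quadruple makes up a quarter of it. *)
Lemma uniform_instance (R : realType) (C : R) (n : nat) (eps alpha xi eta : R) :
  1000 <= C -> (4 <= n)%N -> 0 <= eps < 1 / 2 -> 0 <= alpha < eta -> 0 < xi ->
  eta <= 3 / 4 ->
  exists q phat : fdist R 'I_n, hard_instance C eps alpha xi eta q phat.
Proof.
move=> C1 n4 he hal xi0 eta34.
pose I : finType := ('I_(n %/ 4) * bool)%type.
have cI : #|I| = (n %/ 4 * 2)%N by rewrite card_prod card_ord card_bool.
have k0 : (0 < n %/ 4)%N by rewrite divn_gt0.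
have I0 : (0 < #|I|)%N by rewrite cI muln_gt0 k0.
pose q := fdist_of (unif_pmf R I0).
have qE x : q x = (2 * #|I|%:R)^-1 by rewrite /q/= /pert mulr0 addr0 mul1r.
have m0 : (0 : R) < #|I|%:R by rewrite ltr0n.
(* [q * (1 + u)] is uniform on a quarter of the support of [q]: the pairs are
   themselves indexed by pairs. *)
pose u (x : I * bool) : R := if x.1.2 && x.2 then 3 else -1.
have sumE (F : R -> R) : \sum_x q x * F (u x) = (F 3 + F (-1) *+ 3) / 4.
  rewrite sum_pairs sum_pairs; under eq_bigr do rewrite !qE /u/=.
  rewrite sumr_const card_ord -[LHS]mulr_natl cI natrM.
  have : (n %/ 4)%:R != 0 :> R by rewrite pnatr_eq0 -lt0n.
  by move=> k1; field.
apply: (@tilt_instance _ C n (I * bool)%type q u #|I|%:R) => //.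
- exact: leq_trans n4.
- by rewrite card_prod card_bool cI -mulnA leq_divM.
- rewrite -natrM ler_nat cI; apply: leq_trans (ltnW (ltn_ceil n (isT : 0 < 4)%N)) _.
  by rewrite mulnC leq_mul2l/= muln2 -addnn -addn1 leq_add2l.
- by rewrite ler1n.
- by move=> x; rewrite /u; case: ifP => _; lra.
- by rewrite (sumE id)/=; field.
- by rewrite (sumE (fun t => `|t|))/= normrN normr1 ger0_norm//; field.
- by rewrite (sumE (fun t => t ^+ 2))/=; lra.
move=> s gam f /andP[eg g1] f1 fxi hq hp.
have g01 : 0 < gam <= 1 by case/andP: he => *; apply/andP; split; lra.
have /andP[g0 _] := g01.
have [|a1 a2 a3 a4] := paninski_lower I0 g01 (ltW xi0) f1 fxi hq.
  move=> z; apply: (hp (fdist_of (paninski_pmf I0 g01 z))).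
  by rewrite dTV_half_l1 (paninski_l1 I0 g01) mulrC.
have S0 := ler0n R s.
set S : R := s%:R in S0 a1 a2 a3 a4 *.
have C2 : 50 <= C ^+ 2 by rewrite expr2; nra.
have weaken (c M X : R) : 0 <= X -> c <= 50 -> 50 <= M -> c * X <= M * X.
  by move=> X0 cM M0; rewrite ler_wpM2r//; lra.
split.
- by apply: le_trans a1 _; apply: weaken => //; [rewrite !mulr_ge0 ?exprn_ge0 ?(ltW g0) ?(ltW xi0)|lra].
- by apply: le_trans a2 _; apply: weaken => //; rewrite !mulr_ge0 ?exprn_ge0 ?(ltW g0) ?(ltW xi0).
- by apply: le_trans a3 _; apply: weaken => //; [rewrite !mulr_ge0 ?exprn_ge0 ?(ltW g0) ?(ltW xi0)|lra].
- by apply: le_trans a4 _; apply: weaken => //; [rewrite !mulr_ge0 ?(ltW g0) ?(ltW xi0)|lra|lra].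
Qed.

(** * Choice of the instance according to the gap and to [n] *)

Theorem theorem10 (R : realType) :
  exists c : R, 0 < c /\
  forall (n : nat) (eps alpha xi eta : R),
  (2 <= n)%N ->
  0 <= eps < 1 / 2 -> 0 <= alpha < 1 / 2 -> 0 < xi ->
  alpha < eta <= 1 ->
  exists q phat : fdist R 'I_n,
    dTV q phat = eta /\
    forall (s : nat) (A : algorithm R n s),
      dp xi A ->
      augmented_tester q phat eps alpha (1 / 5) A ->
      (c%:E * Order.min (prediction_rate (eta - alpha) xi)%:E
                        (identity_rate n eps xi)
       <= s%:R%:E)%E.
Proof.
have [C C1] : exists C : R, 1000 <= C by exists 1000.
exists (50 * C)^-1; split; first by rewrite invr_gt0; lra.
move=> n eps alpha xi eta n2 he /andP[al0 al1] xi0 /andP[aleta eta1].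
have hal : 0 <= alpha < eta by rewrite al0.
have [gap|gap] := lerP (alpha + 1 / 16) eta.
  by apply: large_gap_instance => //; rewrite gap.
(* Here [eta < 1 / 2 + 1 / 16], within reach of the tilts. *)
have eta34 : eta <= 3 / 4 by lra.
have [n4|n4] := ltnP n 4; last exact: uniform_instance.
by apply: two_point_instance => //; rewrite n2.
Qed.
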